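(* For every FR$^+$-algebra $A$ there exist an ultrapower ${}^*[0,1]$ of the standard fMV-algebra $[0,1]$ and a set $I$ such that $A$ embeds (as an fMV-algebra) into the direct power $({}^*[0,1])^I$.
   Context: An MV-algebra is a structure $(A,\oplus,{}^*,0)$ with $(A,\oplus,0)$ a commutative monoid, $(x^* )^*=x$, $x\oplus 0^*=0^*$ and $(x^*\oplus y)^*\oplus y=(y^*\oplus x)^*\oplus x$; put $1=0^*$, $x\odot y=(x^*\oplus y^* )^*$, order $x\le y$ iff $x\odot y^*=0$ (a lattice order, $x\wedge y=x\odot(x^*\oplus y)$). A PMVf-algebra is an MV-algebra with an associative binary operation $\cdot$ satisfying $z\cdot(x\odot(x\wedge y)^* )=(z\cdot x)\odot(z\cdot(x\wedge y))^*$, $(x\odot(x\wedge y)^* )\cdot z=(x\cdot z)\odot((x\wedge y)\cdot z)^*$, and: $x\wedge y=0$ implies $(x\cdot z)\wedge y=(z\cdot x)\wedge y=0$. A Riesz MV-algebra is an MV-algebra with unary operations $x\mapsto\alpha x$ ($\alpha\in[0,1]$) with $\alpha(x\odot y^* )=(\alpha x)\odot(\alpha y)^*$, $\max(0,\alpha-\beta)x=(\alpha x)\odot(\beta x)^*$, $\alpha(\beta x)=(\alpha\beta)x$, $1x=x$. An fMV-algebra is a structure $(A,\oplus,\cdot,{}^*,\{\alpha\}_{\alpha\in[0,1]},0)$ which is a PMVf-algebra and a Riesz MV-algebra (sharing the MV-structure) with $\alpha(x\cdot y)=(\alpha x)\cdot y=x\cdot(\alpha y)$. An FR$^+$-algebra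 is an fMV-algebra that is unital ($\cdot$ has an identity element), commutative and semiprime ($x^n=0$ for some $n\ge1$ implies $x=0$). The standard fMV-algebra $[0,1]$ has $x\oplus y=\min(1,x+y)$, $x^*=1-x$, and both product and scalar multiplication equal to the real product; ultrapowers are taken in the signature of fMV-algebras. *)

(* Defs.v *)
From HB Require Import structures.
From mathcomp Require Import all_boot all_order all_algebra.
From mathcomp Require Import lra.
From mathcomp Require Import interval_inference generic_quotient.
From mathcomp Require Import boolp classical_sets filter reals.

Set Implicit Arguments.
Unset Strict Implicit.
Unset Printing Implicit Defensive.
Import Order.TTheory GRing.Theory Num.Theory.

Declare Scope mv_scope.
Delimit Scope mv_scope with mv.

HB.mixin Record isMV T := {
  mv_add : T -> T -> T;
  mv_neg : T -> T;
  mv_zero : T;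
  mv_addA : associative mv_add;
  mv_addC : commutative mv_add;
  mv_add0 : right_id mv_zero mv_add;
  mv_negK : involutive mv_neg;
  mv_add1 : forall x, mv_add x (mv_neg mv_zero) = mv_neg mv_zero;
  mv_lukasiewicz : forall x y,
    mv_add (mv_neg (mv_add (mv_neg x) y)) y =
    mv_add (mv_neg (mv_add (mv_neg y) x)) x
}.

#[short(type="mvType")]
HB.structure Definition MV := { T of isMV T }.

Arguments mv_zero {s}.

Notation "x ⊕ y" := (mv_add x y) (at level 50, left associativity) : mv_scope.
Notation "x ^*" := (mv_neg x) : mv_scope.
Notation "0" := mv_zero : mv_scope.

Definition mv_mul (T : mvType) (x y : T) : T := (x^* ⊕ y^*)^*%mv.
Notation "x ⊙ y" := (mv_mul x y) (at level 40, left associativity) : mv_scope.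

Definition mv_meet (T : mvType) (x y : T) : T := (x ⊙ (x^* ⊕ y))%mv.
Notation "x ⊓ y" := (mv_meet x y) (at level 48, left associativity) : mv_scope.

HB.mixin Record MV_isPMVf T of MV T := {
  pmv_mul : T -> T -> T;
  pmv_mulA : associative pmv_mul;
  pmv_mulBr : forall z x y : T,
    pmv_mul z (x ⊙ (x ⊓ y)^*)%mv = (pmv_mul z x ⊙ (pmv_mul z (x ⊓ y))^*)%mv;
  pmv_mulBl : forall z x y : T,
    pmv_mul (x ⊙ (x ⊓ y)^*)%mv z = (pmv_mul x z ⊙ (pmv_mul (x ⊓ y) z)^*)%mv;
  pmv_fl : forall x y z : T, (x ⊓ y = 0)%mv -> (pmv_mul x z ⊓ y = 0)%mv;
  pmv_fr : forall x y z : T, (x ⊓ y = 0)%mv -> (pmv_mul z x ⊓ y = 0)%mv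
}.

#[short(type="pmvfType")]
HB.structure Definition PMVf := { T of MV T & MV_isPMVf T }.

Notation "x ⋅ y" := (pmv_mul x y) (at level 40, left associativity) : mv_scope.

HB.mixin Record MV_isRieszMV (R : realType) T of MV T := {
  mv_scale : {i01 R} -> T -> T;
  mv_scaleBr : forall (a : {i01 R}) (x y : T),
    mv_scale a (x ⊙ y^*)%mv = (mv_scale a x ⊙ (mv_scale a y)^*)%mv;
  mv_scaleBl : forall (a b : {i01 R}) (x : T),
    mv_scale (Num.max 0 (a%:num - b%:num))%:i01%R x =
    (mv_scale a x ⊙ (mv_scale b x)^*)%mv;
  mv_scaleA : forall (a b : {i01 R}) (x : T),
    mv_scale a (mv_scale b x) = mv_scale (a%:num * b%:num)%:i01%R x;
  mv_scale1 : forall x : T, mv_scale 1%:i01%R x = x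
}.

#[short(type="rieszMVType")]
HB.structure Definition RieszMV (R : realType) :=
  { T of MV T & MV_isRieszMV R T }.

Notation "a ⊡ x" := (mv_scale a x) (at level 40, left associativity) : mv_scope.

HB.mixin Record PMVf_RieszMV_isFMV (R : realType) T
    of PMVf T & RieszMV R T := {
  fmv_scaleAl : forall (a : {i01 R}) (x y : T),
    (a ⊡ (x ⋅ y) = (a ⊡ x) ⋅ y)%mv;
  fmv_scaleAr : forall (a : {i01 R}) (x y : T),
    (a ⊡ (x ⋅ y) = x ⋅ (a ⊡ y))%mv
}.

#[short(type="fmvType")]
HB.structure Definition FMV (R : realType) :=
  { T of PMVf T & RieszMV R T & PMVf_RieszMV_isFMV R T }.

(* [iterop n op x x0] is the n-fold [op]-power of [x] for 0 < n. *)
HB.mixin Record FMV_isFRplus (R : realType) T of FMV R T := {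
  frp_unital : exists e : T, forall x : T, (e ⋅ x = x /\ x ⋅ e = x)%mv;
  frp_mulC : commutative (@pmv_mul T);
  frp_semiprime : forall (x : T) (n : nat), (0 < n)%N ->
    (iterop n (@pmv_mul T) x 0 = 0)%mv -> (x = 0)%mv
}.

#[short(type="frplusType")]
HB.structure Definition FRplus (R : realType) :=
  { T of FMV R T & FMV_isFRplus R T }.

Record fmv_morphism (R : realType) (A B : fmvType R) (f : A -> B) : Prop := {
  fmv_morphD : forall x y, (f (x ⊕ y) = f x ⊕ f y)%mv;
  fmv_morphN : forall x, (f x^* = (f x)^*)%mv;
  fmv_morph0 : (f 0 = 0)%mv;
  fmv_morphM : forall x y, (f (x ⋅ y) = f x ⋅ f y)%mv;
  fmv_morphZ : forall (a : {i01 R}) x, (f (a ⊡ x) = a ⊡ f x)%mv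
}.

Definition fmv_embedding (R : realType) (A B : fmvType R) (f : A -> B) : Prop :=
  fmv_morphism f /\ injective f.

(* An alias, so that the instances are not attached to every {itv R & i}. *)
Definition unit_interval (R : realType) : Type := {i01 R}.

Section Standard.
Variable R : realType.
Local Open Scope ring_scope.
Local Notation num x := ((x : {i01 R})%:num) (only parsing).
Implicit Types (x y z : unit_interval R) (a b : {i01 R}).

Definition std_add x y : unit_interval R := (Num.min 1 (num x + num y))%:i01.
Definition std_neg x : unit_interval R := (1 - num x)%:i01.
Definition std_zero : unit_interval R := 0%:i01.
Definition std_mul x y : unit_interval R := (num x * num y)%:i01.
Definition std_scale a x : unit_interval R := (num a * num x)%:i01.

Let std_ge0 x : 0 <= num x. Proof. exact: ge0. Qed.
Let std_le1 x : num x <= 1. Proof. exact: le1. Qed.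
Let std_inj x y : num x = num y -> x = y. Proof. exact: val_inj. Qed.

Local Ltac std_case a b := lazymatch constr:((a, b)) with
  | context [Order.min _ _] => fail
  | context [Order.max _ _] => fail
  | _ => case: (leP a b) => ?
  end.

Local Ltac std := move=> *; repeat match goal with x : unit_interval _ |- _ =>
    have := std_le1 x; have := std_ge0 x; move: (num x) => {x}
  end; move=> /= *; repeat match goal with
    | |- context [Order.min ?a ?b] => std_case a b
    | |- context [Order.max ?a ?b] => std_case a b
  end; lra.

Lemma std_addA : associative std_add.
Proof. by move=> x y z; apply: std_inj => /=; std. Qed.

Lemma std_addC : commutative std_add.
Proof. by move=> x y; apply: std_inj => /=; std. Qed.

Lemma std_add0 : right_id std_zero std_add.
Proof. by move=> x; apply: std_inj => /=; std. Qed.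

Lemma std_negK : involutive std_neg.
Proof. by move=> x; apply: std_inj => /=; std. Qed.

Lemma std_add1 x : std_add x (std_neg std_zero) = std_neg std_zero.
Proof. by apply: std_inj => /=; std. Qed.

Lemma std_lukasiewicz x y :
  std_add (std_neg (std_add (std_neg x) y)) y =
  std_add (std_neg (std_add (std_neg y) x)) x.
Proof. by apply: std_inj => /=; std. Qed.

HB.instance Definition _ := isMV.Build (unit_interval R) std_addA std_addC
  std_add0 std_negK std_add1 std_lukasiewicz.

Let std_diffE x y :
  num (x ⊙ y^*)%mv = Num.max 0 (num x - num y).
Proof. by rewrite /mv_mul /mv_neg /mv_add /=; std. Qed.

Let std_meetE x y :
  num (x ⊓ y)%mv = Num.min (num x) (num y).
Proof. by rewrite /mv_meet /mv_mul /mv_neg /mv_add /=; std. Qed.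

Let std_mulE x y : num (std_mul x y) = num x * num y. Proof. by []. Qed.

Let std_mul_diff z x y :
  std_mul z (x ⊙ y^*)%mv = (std_mul z x ⊙ (std_mul z y)^*)%mv.
Proof.
apply: std_inj; rewrite std_mulE !std_diffE !std_mulE maxr_pMr ?std_ge0 //.
by rewrite mulr0 mulrBr.
Qed.

Lemma std_mulA : associative std_mul.
Proof. by move=> x y z; apply: std_inj; rewrite /= mulrA. Qed.

Lemma std_mulC : commutative std_mul.
Proof. by move=> x y; apply: std_inj; rewrite /= mulrC. Qed.

Lemma std_mulBr z x y :
  std_mul z (x ⊙ (x ⊓ y)^*)%mv =
  (std_mul z x ⊙ (std_mul z (x ⊓ y))^*)%mv.
Proof. exact: std_mul_diff. Qed.

Lemma std_mulBl z x y :
  std_mul (x ⊙ (x ⊓ y)^*)%mv z =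
  (std_mul x z ⊙ (std_mul (x ⊓ y) z)^*)%mv.
Proof.
by rewrite (std_mulC _ z) std_mul_diff (std_mulC x) (std_mulC (x ⊓ y)%mv).
Qed.

Lemma std_fl x y z :
  (x ⊓ y = 0)%mv -> (std_mul x z ⊓ y = 0)%mv.
Proof.
move=> /(congr1 (fun t => num t)); rewrite std_meetE => xy0.
apply: std_inj; rewrite std_meetE /=; move: xy0 => /=.
have := std_ge0 y; have := std_ge0 x; have := std_ge0 z; have := std_le1 z.
by rewrite !minEle; do 2!case: ifPn => ?; nra.
Qed.

Lemma std_fr x y z :
  (x ⊓ y = 0)%mv -> (std_mul z x ⊓ y = 0)%mv.
Proof. by rewrite std_mulC; exact: std_fl. Qed.

HB.instance Definition _ := MV_isPMVf.Build (unit_interval R)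
  std_mulA std_mulBr std_mulBl std_fl std_fr.

Let std_scaleE a x : num (std_scale a x) = a%:num * num x. Proof. by []. Qed.

Lemma std_scaleBr a x y :
  std_scale a (x ⊙ y^*)%mv =
  (std_scale a x ⊙ (std_scale a y)^*)%mv.
Proof. exact: std_mul_diff. Qed.

Lemma std_scaleBl a b x :
  std_scale (Num.max 0 (a%:num - b%:num))%:i01 x =
  (std_scale a x ⊙ (std_scale b x)^*)%mv.
Proof.
apply: std_inj; rewrite std_diffE !std_scaleE maxr_pMl ?std_ge0 //.
by rewrite mul0r mulrBl.
Qed.

Lemma std_scaleA a b x :
  std_scale a (std_scale b x) = std_scale (a%:num * b%:num)%:i01 x.
Proof. by apply: std_inj; rewrite /= mulrA. Qed.

Lemma std_scale1 x : std_scale 1%:i01 x = x.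
Proof. by apply: std_inj; rewrite /= mul1r. Qed.

HB.instance Definition _ := MV_isRieszMV.Build R (unit_interval R)
  std_scaleBr std_scaleBl std_scaleA std_scale1.

Lemma std_scaleAl a x y : (a ⊡ (x ⋅ y) = (a ⊡ x) ⋅ y)%mv.
Proof. exact: (std_mulA a x y). Qed.

Lemma std_scaleAr a x y : (a ⊡ (x ⋅ y) = x ⋅ (a ⊡ y))%mv.
Proof.
have -> : (x ⋅ (a ⊡ y) = (a ⊡ y) ⋅ x)%mv by exact: std_mulC.
have -> : (x ⋅ y = y ⋅ x)%mv by exact: std_mulC.
exact: std_scaleAl.
Qed.

HB.instance Definition _ := PMVf_RieszMV_isFMV.Build R (unit_interval R)
  std_scaleAl std_scaleAr.

End Standard.

Section DirectPowerMV.
Variables (I : Type) (T : mvType).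
Implicit Types x y z : I -> T.

Definition pw_add x y : I -> T := fun i => (x i ⊕ y i)%mv.
Definition pw_neg x : I -> T := fun i => (x i)^*%mv.
Definition pw_zero : I -> T := fun=> 0%mv.

Let addA : associative pw_add.
Proof. by move=> x y z; apply/funext => i; exact: mv_addA. Qed.
Let addC : commutative pw_add.
Proof. by move=> x y; apply/funext => i; exact: mv_addC. Qed.
Let add0 : right_id pw_zero pw_add.
Proof. by move=> x; apply/funext => i; exact: mv_add0. Qed.
Let negK : involutive pw_neg.
Proof. by move=> x; apply/funext => i; exact: mv_negK. Qed.
Let add1 x : pw_add x (pw_neg pw_zero) = pw_neg pw_zero.
Proof. by apply/funext => i; exact: mv_add1. Qed.
Let lukasiewicz x y :
  pw_add (pw_neg (pw_add (pw_neg x) y)) y =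
  pw_add (pw_neg (pw_add (pw_neg y) x)) x.
Proof. by apply/funext => i; exact: mv_lukasiewicz. Qed.

HB.instance Definition _ :=
  isMV.Build (I -> T) addA addC add0 negK add1 lukasiewicz.

End DirectPowerMV.

Section DirectPowerPMVf.
Variables (I : Type) (T : pmvfType).
Implicit Types x y z : I -> T.

Definition pw_mul x y : I -> T := fun i => (x i ⋅ y i)%mv.

Let mulA : associative pw_mul.
Proof. by move=> x y z; apply/funext => i; exact: pmv_mulA. Qed.
Let mulBr z x y :
  pw_mul z (x ⊙ (x ⊓ y)^*)%mv = (pw_mul z x ⊙ (pw_mul z (x ⊓ y))^*)%mv.
Proof. by apply/funext => i; exact: pmv_mulBr. Qed.
Let mulBl z x y :
  pw_mul (x ⊙ (x ⊓ y)^*)%mv z = (pw_mul x z ⊙ (pw_mul (x ⊓ y) z)^*)%mv.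
Proof. by apply/funext => i; exact: pmv_mulBl. Qed.
Let fl x y z : (x ⊓ y = 0)%mv -> (pw_mul x z ⊓ y = 0)%mv.
Proof.
by move=> xy0; apply/funext => i; apply: pmv_fl; exact: (congr1 (@^~ i) xy0).
Qed.
Let fr x y z : (x ⊓ y = 0)%mv -> (pw_mul z x ⊓ y = 0)%mv.
Proof.
by move=> xy0; apply/funext => i; apply: pmv_fr; exact: (congr1 (@^~ i) xy0).
Qed.

HB.instance Definition _ := MV_isPMVf.Build (I -> T) mulA mulBr mulBl fl fr.

End DirectPowerPMVf.

Section DirectPowerRieszMV.
Variables (R : realType) (I : Type) (T : rieszMVType R).
Implicit Types (x y : I -> T) (a b : {i01 R}).

Definition pw_scale a x : I -> T := fun i => (a ⊡ x i)%mv.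

Let scaleBr a x y :
  pw_scale a (x ⊙ y^*)%mv = (pw_scale a x ⊙ (pw_scale a y)^*)%mv.
Proof. by apply/funext => i; exact: mv_scaleBr. Qed.
Let scaleBl a b x : pw_scale (Num.max 0 (a%:num - b%:num))%:i01%R x =
  (pw_scale a x ⊙ (pw_scale b x)^*)%mv.
Proof. by apply/funext => i; exact: mv_scaleBl. Qed.
Let scaleA a b x :
  pw_scale a (pw_scale b x) = pw_scale (a%:num * b%:num)%:i01%R x.
Proof. by apply/funext => i; exact: mv_scaleA. Qed.
Let scale1 x : pw_scale 1%:i01%R x = x.
Proof. by apply/funext => i; exact: mv_scale1. Qed.

HB.instance Definition _ :=
  MV_isRieszMV.Build R (I -> T) scaleBr scaleBl scaleA scale1.

End DirectPowerRieszMV.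

Section DirectPowerFMV.
Variables (R : realType) (I : Type) (T : fmvType R).
Implicit Types (x y : I -> T) (a : {i01 R}).

Let scaleAl a x y : (a ⊡ (x ⋅ y) = (a ⊡ x) ⋅ y)%mv.
Proof. by apply/funext => i; exact: fmv_scaleAl. Qed.
Let scaleAr a x y : (a ⊡ (x ⋅ y) = x ⋅ (a ⊡ y))%mv.
Proof. by apply/funext => i; exact: fmv_scaleAr. Qed.

HB.instance Definition _ :=
  PMVf_RieszMV_isFMV.Build R (I -> T) scaleAl scaleAr.

End DirectPowerFMV.

Section Ultrapower.
Variables (J : Type) (U : set_system J) (UU : UltraFilter U) (T : Type).
Local Open Scope classical_set_scope.
Local Open Scope quotient_scope.

Definition ultra_eq : rel {classic J -> T} :=
  fun f g => `[< U [set j | f j = g j] >].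

Lemma ultra_eq_refl : reflexive ultra_eq.
Proof. by move=> f; apply/asboolP; apply: filterE. Qed.

Lemma ultra_eq_sym : symmetric ultra_eq.
Proof.
by move=> f g; apply/asboolP/asboolP; apply: filterS => j /= /esym.
Qed.

Lemma ultra_eq_trans : transitive ultra_eq.
Proof.
move=> g f h /asboolP fg /asboolP gh; apply/asboolP.
by apply: filterS2 fg gh => j /= -> .
Qed.

Canonical ultra_equiv :=
  EquivRel ultra_eq ultra_eq_refl ultra_eq_sym ultra_eq_trans.

Definition ultrapower : Type := {eq_quot ultra_equiv}.

Definition ultra_class (f : J -> T) : ultrapower := \pi_({eq_quot ultra_equiv}) f.

Definition ultra_repr (x : ultrapower) : J -> T :=
  repr (x : {eq_quot ultra_equiv}).

Lemma ultra_reprK : cancel ultra_repr ultra_class.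
Proof. exact: reprK. Qed.

Lemma ultra_classP (f g : J -> T) :
  ultra_class f = ultra_class g <-> U [set j | f j = g j].
Proof. by split=> [/eqmodP/asboolP|fg]; last by apply/eqmodP/asboolP. Qed.

Lemma ultra_repr_class (f : J -> T) :
  U [set j | ultra_repr (ultra_class f) j = f j].
Proof. by apply/ultra_classP; rewrite ultra_reprK. Qed.

Lemma ultra_ind (P : ultrapower -> Prop) :
  (forall f, P (ultra_class f)) -> forall x, P x.
Proof. by move=> Pf x; rewrite -(ultra_reprK x). Qed.

End Ultrapower.

Arguments ultrapower {J U} UU T.
Arguments ultra_class {J U} UU {T} f.

(* Locked, so that unification does not unfold the operations of an ultrapower
   down to [ultra_class]. *)
HB.lock Definition ultra_op1 (J : Type) (U : set_system J)
    (UU : UltraFilter U) (T : Type) (op : T -> T) (x : ultrapower UU T) :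
    ultrapower UU T :=
  ultra_class UU (op \o ultra_repr x).

HB.lock Definition ultra_op2 (J : Type) (U : set_system J)
    (UU : UltraFilter U) (T : Type) (op : T -> T -> T)
    (x y : ultrapower UU T) : ultrapower UU T :=
  ultra_class UU (fun j => op (ultra_repr x j) (ultra_repr y j)).

Arguments ultra_op1 {J U UU T} op x.
Arguments ultra_op2 {J U UU T} op x y.

Section UltrapowerOperations.
Variables (J : Type) (U : set_system J) (UU : UltraFilter U) (T : Type).

Lemma ultra_op1E op (f : J -> T) :
  ultra_op1 op (ultra_class UU f) = ultra_class UU (op \o f).
Proof.
rewrite ultra_op1.unlock; apply/ultra_classP.
by apply: filterS (ultra_repr_class UU f) => j /= ->.
Qed.

Lemma ultra_op2E op (f g : J -> T) :
  ultra_op2 op (ultra_class UU f) (ultra_class UU g) =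
  ultra_class UU (fun j => op (f j) (g j)).
Proof.
rewrite ultra_op2.unlock; apply/ultra_classP.
by apply: filterS2 (ultra_repr_class UU f) (ultra_repr_class UU g) => j /= -> ->.
Qed.

End UltrapowerOperations.

Section UltrapowerMV.
Variables (J : Type) (U : set_system J) (UU : UltraFilter U) (T : mvType).
Implicit Types x y z : ultrapower UU T.

Let add : ultrapower UU T -> _ -> _ := ultra_op2 (@mv_add T).
Let neg : ultrapower UU T -> _ := ultra_op1 (@mv_neg T).
Let zero : ultrapower UU T := ultra_class UU (fun=> 0%mv).

Let addA : associative add.
Proof.
elim/ultra_ind => f; elim/ultra_ind => g; elim/ultra_ind => h.
rewrite /add !ultra_op2E; congr ultra_class.
by apply/funext => j; exact: mv_addA.
Qed.

Let addC : commutative add.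
Proof.
elim/ultra_ind => f; elim/ultra_ind => g; rewrite /add !ultra_op2E.
by congr ultra_class; apply/funext => j; exact: mv_addC.
Qed.

Let add0 : right_id zero add.
Proof.
elim/ultra_ind => f; rewrite /add /zero ultra_op2E.
by congr ultra_class; apply/funext => j; exact: mv_add0.
Qed.

Let negK : involutive neg.
Proof.
elim/ultra_ind => f; rewrite /neg !ultra_op1E.
by congr ultra_class; apply/funext => j; exact: mv_negK.
Qed.

Let add1 x : add x (neg zero) = neg zero.
Proof.
elim/ultra_ind: x => f; rewrite /add /neg /zero ultra_op1E ultra_op2E.
by congr ultra_class; apply/funext => j; exact: mv_add1.
Qed.

Let lukasiewicz x y :
  add (neg (add (neg x) y)) y = add (neg (add (neg y) x)) x.
Proof.
elim/ultra_ind: x => f; elim/ultra_ind: y => g.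
rewrite /add /neg !(ultra_op1E, ultra_op2E).
by congr ultra_class; apply/funext => j; exact: mv_lukasiewicz.
Qed.

HB.instance Definition _ :=
  isMV.Build (ultrapower UU T) addA addC add0 negK add1 lukasiewicz.

Lemma ultra_class0 : ultra_class UU (fun=> 0%mv : T) = 0%mv.
Proof. by []. Qed.

Lemma ultra_classD (f g : J -> T) :
  (ultra_class UU f ⊕ ultra_class UU g = ultra_class UU (f ⊕ g))%mv.
Proof. exact: ultra_op2E. Qed.

Lemma ultra_classN (f : J -> T) :
  ((ultra_class UU f)^* = ultra_class UU (f^*))%mv.
Proof. exact: ultra_op1E. Qed.

Lemma ultra_classB (f g : J -> T) :
  (ultra_class UU f ⊙ ultra_class UU g = ultra_class UU (f ⊙ g))%mv.
Proof. by rewrite /mv_mul !ultra_classN ultra_classD ultra_classN. Qed.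

Lemma ultra_classI (f g : J -> T) :
  (ultra_class UU f ⊓ ultra_class UU g = ultra_class UU (f ⊓ g))%mv.
Proof. by rewrite /mv_meet ultra_classN ultra_classD ultra_classB. Qed.

End UltrapowerMV.

Section UltrapowerPMVf.
Variables (J : Type) (U : set_system J) (UU : UltraFilter U) (T : pmvfType).
Implicit Types x y z : ultrapower UU T.

Let mul : ultrapower UU T -> _ -> _ := ultra_op2 (@pmv_mul T).

Let mulE (f g : J -> T) :
  mul (ultra_class UU f) (ultra_class UU g) = ultra_class UU (f ⋅ g)%mv.
Proof. exact: ultra_op2E. Qed.

Let mulA : associative mul.
Proof.
elim/ultra_ind => f; elim/ultra_ind => g; elim/ultra_ind => h.
by rewrite !mulE pmv_mulA.
Qed.

Let mulBr z x y : mul z (x ⊙ (x ⊓ y)^*)%mv = (mul z x ⊙ (mul z (x ⊓ y))^*)%mv.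
Proof.
elim/ultra_ind: x => f; elim/ultra_ind: y => g; elim/ultra_ind: z => h.
by rewrite !(ultra_classI, ultra_classN, ultra_classB, mulE) pmv_mulBr.
Qed.

Let mulBl z x y : mul (x ⊙ (x ⊓ y)^*)%mv z = (mul x z ⊙ (mul (x ⊓ y) z)^*)%mv.
Proof.
elim/ultra_ind: x => f; elim/ultra_ind: y => g; elim/ultra_ind: z => h.
by rewrite !(ultra_classI, ultra_classN, ultra_classB, mulE) pmv_mulBl.
Qed.

Let fl x y z : (x ⊓ y = 0)%mv -> (mul x z ⊓ y = 0)%mv.
Proof.
elim/ultra_ind: x => f; elim/ultra_ind: y => g; elim/ultra_ind: z => h.
rewrite mulE !ultra_classI -ultra_class0 => /ultra_classP fg0.
by apply/ultra_classP; apply: filterS fg0 => j; exact: pmv_fl.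
Qed.

Let fr x y z : (x ⊓ y = 0)%mv -> (mul z x ⊓ y = 0)%mv.
Proof.
elim/ultra_ind: x => f; elim/ultra_ind: y => g; elim/ultra_ind: z => h.
rewrite mulE !ultra_classI -ultra_class0 => /ultra_classP fg0.
by apply/ultra_classP; apply: filterS fg0 => j; exact: pmv_fr.
Qed.

HB.instance Definition _ :=
  MV_isPMVf.Build (ultrapower UU T) mulA mulBr mulBl fl fr.

Lemma ultra_classM (f g : J -> T) :
  (ultra_class UU f ⋅ ultra_class UU g = ultra_class UU (f ⋅ g))%mv.
Proof. exact: mulE. Qed.

End UltrapowerPMVf.

Section UltrapowerRieszMV.
Variables (R : realType) (J : Type) (U : set_system J) (UU : UltraFilter U).
Variable T : rieszMVType R.
Implicit Types (x y : ultrapower UU T) (a b : {i01 R}).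

Let scale a : ultrapower UU T -> ultrapower UU T := ultra_op1 (@mv_scale R T a).

Let scaleE a (f : J -> T) :
  scale a (ultra_class UU f) = ultra_class UU (a ⊡ f)%mv.
Proof. exact: ultra_op1E. Qed.

Let scaleBr a x y : scale a (x ⊙ y^*)%mv = (scale a x ⊙ (scale a y)^*)%mv.
Proof.
elim/ultra_ind: x => f; elim/ultra_ind: y => g.
by rewrite !(ultra_classN, ultra_classB, scaleE) mv_scaleBr.
Qed.

Let scaleBl a b x : scale (Num.max 0 (a%:num - b%:num))%:i01%R x =
  (scale a x ⊙ (scale b x)^*)%mv.
Proof.
elim/ultra_ind: x => f.
by rewrite !(ultra_classN, ultra_classB, scaleE) mv_scaleBl.
Qed.

Let scaleA a b x : scale a (scale b x) = scale (a%:num * b%:num)%:i01%R x.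
Proof. by elim/ultra_ind: x => f; rewrite !scaleE mv_scaleA. Qed.

Let scale1 x : scale 1%:i01%R x = x.
Proof. by elim/ultra_ind: x => f; rewrite scaleE mv_scale1. Qed.

HB.instance Definition _ := MV_isRieszMV.Build R (ultrapower UU T)
  scaleBr scaleBl scaleA scale1.

Lemma ultra_classZ a (f : J -> T) :
  (a ⊡ ultra_class UU f = ultra_class UU (a ⊡ f))%mv.
Proof. exact: scaleE. Qed.

End UltrapowerRieszMV.

Section UltrapowerFMV.
Variables (R : realType) (J : Type) (U : set_system J) (UU : UltraFilter U).
Variable T : fmvType R.
Implicit Types (x y : ultrapower UU T) (a : {i01 R}).

Let scaleAl a x y : (a ⊡ (x ⋅ y) = (a ⊡ x) ⋅ y)%mv.
Proof.
elim/ultra_ind: x => f; elim/ultra_ind: y => g.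
by rewrite !(ultra_classM, ultra_classZ) fmv_scaleAl.
Qed.

Let scaleAr a x y : (a ⊡ (x ⋅ y) = x ⋅ (a ⊡ y))%mv.
Proof.
elim/ultra_ind: x => f; elim/ultra_ind: y => g.
by rewrite !(ultra_classM, ultra_classZ) fmv_scaleAr.
Qed.

HB.instance Definition _ :=
  PMVf_RieszMV_isFMV.Build R (ultrapower UU T) scaleAl scaleAr.

End UltrapowerFMV.

(* Main.v *)
Require Import Defs.
From HB Require Import structures.
From mathcomp Require Import all_boot all_order all_algebra.
From mathcomp Require Import ring lra zify.
From mathcomp Require Import interval_inference generic_quotient ring_quotient.
From mathcomp Require Import boolp classical_sets filter reals.

(** [A] is the unit interval of a commutative lattice-ordered ring [D], built
    here from formal combinations of elements of [A] with real coefficients.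
    By Zorn's lemma the positive cone of [D] extends to a total prime cone
    avoiding a given [- a], so that [D] maps to an ordered field [K] with
    [0 < a]: reducedness keeps the powers of [a] nonzero, and the f-ring
    condition [u /\ v = 0 -> u v = 0] makes the map to a domain preserve the
    lattice operations.  A finite part of [A] thus satisfies finitely many sign
    conditions in an ordered extension [K] of the reals; by the Artin-Lang
    principle they have a solution in the reals, hence in [0,1].  An ultrafilter
    on the finite parts of [A] glues these partial homomorphisms into a map from
    [A] to an ultrapower of [0,1] for each [a <> 0], and the ultrafilter does not
    depend on [a].

    Artin-Lang is proved one variable at a time by the Cohen-Hormander method:
    for a finite set of polynomials closed under truncation, derivation and
    remainder, the signs of the leading coefficients determine the sign table.
    This needs the intermediate value property, which holds for the finitely many
    polynomials involved in an ordered extension of [K] where they have as many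
    roots as possible. *)

Set Implicit Arguments.
Unset Strict Implicit.
Unset Printing Implicit Defensive.
Import Order.TTheory GRing.Theory Num.Theory.
Local Open Scope ring_scope.

(** * Total prime cones and ordered fields *)

Section PrimeCone.
Variable B : comNzRingType.
Implicit Types (T : set B) (x y z : B).

(** Homomorphisms from [A] to [[0,1]] kill infinitesimals, and the fields [K] obtained from the
    envelope are in general non-archimedean, hence not embeddable in the reals. So only finite parts
    of [A] are mapped to [[0,1]], which calls for a transfer principle.

    The delicate operation is the truncated sum. The overflow [x ⊙ y] and the deficit [1 - (x ⊕ y)]
    are lattice-disjoint, so their product is zero; in a domain one of them vanishes, and [x ⊕ y]
    becomes [min(1, x + y)].

    No real closure of [K] is built: a sign table involves finitely many polynomials, and
    intermediate values are required for these only. Adjoining a root is a second use of the cone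
    theorem, applied to weighted sums of squares modulo a polynomial.

    Formal combinations are evaluated inside [A] after scaling by a small [t > 0], which keeps all
    sums below 1. *)

Definition preordering T := [/\ forall x y, T x -> T y -> T (x + y),
  forall x y, T x -> T y -> T (x * y) & forall x, T (x * x)].

Definition total_prime_cone T := [/\ preordering T,
  forall x, T x \/ T (- x), ~ T (- 1) &
  forall x y, T (x * y) -> T (- (x * y)) ->
    (T x /\ T (- x)) \/ (T y /\ T (- y))].

(** Excluding every [- a ^+ k], and not only [- a], is what makes the support of a maximal
    preordering prime; the case [k = 0] excludes [-1]. *)
Lemma preordering_max T0 a : preordering T0 -> (forall k, ~ T0 (- a ^+ k)) ->
  exists T, [/\ T0 `<=` T, preordering T, forall k, ~ T (- a ^+ k) &
    forall T', preordering T' -> T `<=` T' -> (forall k, ~ T' (- a ^+ k)) ->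
      T' `<=` T]%classic.
Proof.
move=> T0P T0a.
pose good T := [/\ T0 `<=` T, preordering T & forall k, ~ T (- a ^+ k)]%classic.
have goodT0 : good T0 by split.
have T01 : T0 1 by case: T0P => _ _ /(_ 1); rewrite mulr1.
(* The empty chain has union [set0], so the Zorn predicate must admit it; [T0], which contains 1,
   shows that [set0] is not maximal. *)
have [F FP Ftot|T [PT Tmax]] := @Zorn_bigcup B (fun T => T = set0 \/ good T).
  have [[T1 [FT1 gT1]]|noT] := pselect (exists T, F T /\ good T); last first.
    left; apply/seteqP; split=> // x [T FT Tx].
    by case: (FP _ FT) Tx => [->//|gT]; case: noT; exists T.
  have good_ne T x : F T -> T x -> good T.
    by move=> FT Tx; case: (FP _ FT) Tx => [->|].
  right; have [T0T1 [_ _ sq] _] := gT1.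
  have two x y : (\bigcup_(X in F) X)%classic x ->
      (\bigcup_(X in F) X)%classic y -> exists T, [/\ F T, good T, T x & T y].
    move=> [T FT Tx] [T' FT' T'y].
    have [TT'|T'T] := Ftot _ _ FT FT'.
      by exists T'; split=> //; [exact: good_ne T'y|exact: TT'].
    by exists T; split=> //; [exact: good_ne Tx|exact: T'T].
  split=> [x T0x||k [T FT Ta]]; first by exists T1 => //; exact: T0T1.
    split=> [x y Ux Uy|x y Ux Uy|x].
    - have [T [FT [_ [add _ _] _] Tx Ty]] := two _ _ Ux Uy.
      by exists T => //; exact: add.
    - have [T [FT [_ [_ mul _] _] Tx Ty]] := two _ _ Ux Uy.
      by exists T => //; exact: mul.
    - by exists T1 => //; exact: sq.
  by have [_ _ /(_ k)] := good_ne _ _ FT Ta.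
case: PT => [T0E|gT].
  exfalso; apply: (Tmax T0); last by right.
  by rewrite T0E; split=> // /(_ 1 T01).
have [T0T preT Ta] := gT.
exists T; split=> // T' preT' TT' T'a x T'x; apply: contrapT => nTx.
apply: (Tmax T'); first by split=> // /(_ x T'x).
by right; split=> //; exact: subset_trans TT'.
Qed.

Lemma ex_total_prime_cone T0 a : preordering T0 -> T0 a ->
  (forall k, ~ T0 (- a ^+ k)) ->
  exists T, [/\ T0 `<=` T, total_prime_cone T & ~ T (- a)]%classic.
Proof.
move=> T0P T0a nT0; have [T [T0T [add mul sq] nT Tmax]] := preordering_max T0P nT0.
have T0_ : T 0 by have := sq 0; rewrite mulr0.
have T1 : T 1 by have := sq 1; rewrite mulr1.
have Ta k : T (a ^+ k).
  by elim: k => [|k IH]; rewrite ?expr0 // exprS; apply: mul => //; exact: T0T.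
(* By maximality the preordering [T + x T] contains some [- a ^+ k]: a certificate that [x] is
   outside [T]. *)
have ext x : ~ T x -> exists k s t, [/\ T s, T t & - a ^+ k = s + x * t].
  move=> nTx; pose T' : set B := fun z => exists s t, [/\ T s, T t & z = s + x * t].
  have [[k [s [t [Ts Tt e]]]]|noext] := pselect (exists k, T' (- a ^+ k)).
    by exists k, s, t.
  case: nTx; apply: (Tmax T').
  - split=> [_ _ [s [t [Ts Tt ->]]] [s' [t' [Ts' Tt' ->]]]|
             _ _ [s [t [Ts Tt ->]]] [s' [t' [Ts' Tt' ->]]]|z].
    + by exists (s + s'), (t + t'); split; [exact: add|exact: add|ring].
    + exists (s * s' + x * x * (t * t')), (s * t' + t * s'); split; last ring.
        by apply: (add); [exact: mul|apply: (mul); [exact: sq|exact: mul]].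
      by apply: (add); exact: mul.
    + by exists (z * z), 0; split; [exact: sq|by []|ring].
  - by move=> s Ts; exists s, 0; split=> //; ring.
  - by move=> k T'k; apply: noext; exists k.
  - by exists 0, 1; split=> //; ring.
(* The product of the certificates for [x] and [- x] writes [- a ^+ (k + l)] with elements of [T]
   only: [x] survives as [x * x]. *)
have tot x : T x \/ T (- x).
  have [Tx|/ext[k [s [t [Ts Tt e]]]]] := pselect (T x); first by left.
  have [Tx|/ext[l [u [v [Tu Tv f]]]]] := pselect (T (- x)); first by right.
  exfalso; apply: (nT (k + l)%N); rewrite exprD.
  have -> : - (a ^+ k * a ^+ l) =
      a ^+ k * u + s * (- (- a ^+ l)) + s * u + x * x * (t * v).
    have -> : a ^+ k = - s - x * t by rewrite -(opprK (a ^+ k)) e; ring.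
    have -> : a ^+ l = - u + x * v by rewrite -(opprK (a ^+ l)) f; ring.
    ring.
  rewrite opprK; apply: (add); first apply: (add); first apply: (add).
  - exact: mul.
  - exact: mul.
  - exact: mul.
  - by apply: (mul); [exact: sq|exact: mul].
exists T; split=> //; last by rewrite -[a]expr1; exact: nT.
split=> //; first by rewrite -(expr0 a); exact: nT.
have idl x z : T x -> T (- x) -> T (x * z) /\ T (- (x * z)).
  move=> Tx Tnx; have [Tz|Tz] := tot z.
    by split; [exact: mul|rewrite -mulNr; exact: mul].
  by split; [rewrite -mulrNN; exact: mul|rewrite -mulrN; exact: mul].
(* The same product for [- x] and [- y] leaves the cross term [- (x * y * (t * v))], which is in [T]
   because the support absorbs products. *)
have prime_neg x y : ~ T (- x) -> ~ T (- y) -> T (x * y) -> T (- (x * y)) -> False.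
  move=> /ext[k [s [t [Ts Tt e]]]] /ext[l [u [v [Tu Tv f]]]] Txy Tnxy.
  apply: (nT (k + l)%N); rewrite exprD.
  have [_ Tn] := idl _ (t * v) Txy Tnxy.
  have -> : - (a ^+ k * a ^+ l) =
      a ^+ k * u + s * a ^+ l + s * u + - (x * y * (t * v)).
    have -> : a ^+ k = - s + x * t by rewrite -(opprK (a ^+ k)) e; ring.
    have -> : a ^+ l = - u + y * v by rewrite -(opprK (a ^+ l)) f; ring.
    ring.
  apply: (add) => //; apply: (add); last exact: mul.
  by apply: (add); exact: mul.
move=> x y Txy Tnxy.
have [Tx|Tx] := tot x; have [Ty|Ty] := tot y.
- have [Tx'|nTx] := pselect (T (- x)); first by left.
  have [Ty'|nTy] := pselect (T (- y)); first by right.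
  by have := prime_neg _ _ nTx nTy Txy Tnxy.
- have [Tx'|nTx] := pselect (T (- x)); first by left.
  have [Ty'|nTy] := pselect (T y); first by right.
  by case: (@prime_neg x (- y)); rewrite ?mulrN ?opprK.
- have [Tx'|nTx] := pselect (T x); first by left.
  have [Ty'|nTy] := pselect (T (- y)); first by right.
  by case: (@prime_neg (- x) y); rewrite ?mulNr ?opprK.
- have [Tx'|nTx] := pselect (T x); first by left.
  have [Ty'|nTy] := pselect (T y); first by right.
  by case: (@prime_neg (- x) (- y)); rewrite ?mulrNN ?opprK.
Qed.

End PrimeCone.

(** * The ordered fraction field defined by a total prime cone *)

Section ConeField.
Variables (B : comNzRingType) (T : set B) (coneT : total_prime_cone T).
Local Open Scope quotient_scope.

Let add x y : T x -> T y -> T (x + y).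
Proof. by case: coneT => -[h _ _] _ _ _; exact: h. Qed.
Let mul x y : T x -> T y -> T (x * y).
Proof. by case: coneT => -[_ h _] _ _ _; exact: h. Qed.
Let sq x : T (x * x).
Proof. by case: coneT => -[_ _ h] _ _ _; exact: h. Qed.
Let tot x : T x \/ T (- x).
Proof. by case: coneT => _ h _ _; exact: h. Qed.
Let T0 : T 0. Proof. by have := sq 0; rewrite mulr0. Qed.

(** The cone hypothesis is an argument so that the ideal and primality instances, which depend on
    it, can be attached to the predicate. *)
Definition cone_support of total_prime_cone T : pred B :=
  fun x => `[< T x /\ T (- x) >].
Local Notation I := (cone_support coneT).

Let IP x : reflect (T x /\ T (- x)) (x \in I). Proof. exact: asboolP. Qed.

Let idealI : idealr_closed I.
Proof.
split; first by apply/IP; rewrite oppr0.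
  by apply/IP => -[_]; have [] := coneT.
move=> a u v /IP[Tu Tu'] /IP[Tv Tv']; apply/IP.
have [Ta|Ta] := tot a.
  by split; [|rewrite opprD -mulrN]; apply: add => //; apply: mul.
split; first by apply: add => //; rewrite -mulrNN; apply: mul.
by rewrite opprD; apply: add => //; rewrite -mulNr; apply: mul.
Qed.

Let primeI : prime_idealr_closed I.
Proof.
move=> x y /IP[Txy Txy']; have [_ _ _ /(_ _ _ Txy Txy')[h|h]] := coneT.
  by apply/orP; left; apply/IP.
by apply/orP; right; apply/IP.
Qed.

HB.instance Definition _ := isIdealr.Build B I idealI.
HB.instance Definition _ := isPrimeIdealrClosed.Build B I primeI.

Definition cone_ideal : prime_idealr B := PrimeIdealr.clone B I _.

Definition cone_quot : Type := {ideal_quot cone_ideal}.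
HB.instance Definition _ := GRing.ComNzRing.on cone_quot.

(** Fractions are formed over domains that carry a partial inverse; here it is chosen classically,
    and is the identity outside the units. *)
Definition cone_quot_unit (x : cone_quot) := `[< exists y, y * x = 1 >].
Definition cone_quot_inv (x : cone_quot) : cone_quot :=
  if pselect (exists y, y * x = 1) is left xV then projT1 (cid xV) else x.

Let cone_quot_mulVx : {in cone_quot_unit, left_inverse 1 cone_quot_inv *%R}.
Proof.
move=> x /asboolP xV; rewrite /cone_quot_inv; case: pselect => // xV'.
exact: (projT2 (cid xV')).
Qed.
Let cone_quot_unitPl (x y : cone_quot) : y * x = 1 -> cone_quot_unit x.
Proof. by move=> yx; apply/asboolP; exists y. Qed.
Let cone_quot_invr_out : {in [predC cone_quot_unit], cone_quot_inv =1 id}.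
Proof.
move=> x /negP nx; rewrite /cone_quot_inv; case: pselect => // xV.
by case: nx; apply/asboolP.
Qed.
HB.instance Definition _ := GRing.ComNzRing_hasMulInverse.Build cone_quot
  cone_quot_mulVx cone_quot_unitPl cone_quot_invr_out.
HB.instance Definition _ := GRing.ComUnitRing_isIntegral.Build cone_quot
  (@Quotient.rquot_IdomainAxiom B cone_ideal).

Definition cone_field : Type := {fraction cone_quot}.
HB.instance Definition _ := GRing.Field.on cone_field.

Definition cone_map (x : B) : cone_field :=
  FracField.tofrac (\pi_{ideal_quot cone_ideal} x : cone_quot).

Let cone_map_zmod : zmod_morphism cone_map.
Proof. by move=> x y; rewrite /cone_map rmorphB -tofracB. Qed.
Let cone_map_monoid : monoid_morphism cone_map.
Proof.
by split=> [|x y]; rewrite /cone_map ?rmorph1 -?tofrac1 // rmorphM -tofracM.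
Qed.
HB.instance Definition _ := GRing.isZmodMorphism.Build B cone_field
  cone_map cone_map_zmod.
HB.instance Definition _ := GRing.isMonoidMorphism.Build B cone_field
  cone_map cone_map_monoid.

Let cone_map_eq0 x : (cone_map x == 0) = (x \in I).
Proof.
rewrite /cone_map tofrac_eq0 -[RHS](congr1 (fun y => y \in I) (subr0 x)).
rewrite (@Quotient.idealrBE _ cone_ideal).
by rewrite -(rmorph0 (\pi_{ideal_quot cone_ideal})).
Qed.

Let cone_fieldP (x : cone_field) :
  exists n d, d \notin I /\ x = cone_map n / cone_map d.
Proof.
elim/quotW: x => r; have dr := denom_ratioP r.
exists (repr (\n_r : {ideal_quot cone_ideal})).
exists (repr (\d_r : {ideal_quot cone_ideal})); split.
  by rewrite -cone_map_eq0 /cone_map reprK tofrac_eq0.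
rewrite /cone_map !reprK; apply: (canRL (mulfK _)); first by rewrite tofrac_eq0.
unlock FracField.tofrac; rewrite !piE; apply/eqP.
rewrite piE /FracField.equivf /FracField.mulf /=.
have pi1 : \pi_{ideal_quot cone_ideal} 1 = 1 :> cone_quot by exact: rmorph1.
by rewrite !numden_Ratio pi1 ?oner_eq0 ?mulf_neq0 ?oner_eq0 // !mulr1 mulrC.
Qed.

(** The sign of [n / d] is that of [n * d], which spares a choice of positive denominators. *)
Let pos (x : cone_field) :=
  `[< exists n d, [/\ d \notin I, x = cone_map n / cone_map d & T (n * d)] >].

Let posE n d : d \notin I -> pos (cone_map n / cone_map d) = `[< T (n * d) >].
Proof.
move=> dI; apply/idP/idP => /asboolP; last by move=> Tnd; apply/asboolP; exists
  n, d.
move=> [m [e [eI eqnm Tme]]]; apply/asboolP.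
have d0 : cone_map d != 0 by rewrite cone_map_eq0.
have e0 : cone_map e != 0 by rewrite cone_map_eq0.
have eqI : cone_map (n * e - m * d) = 0.
  move/eqP: eqnm; rewrite (eqr_div _ _ d0 e0) => /eqP eqnm.
  by rewrite rmorphB !rmorphM eqnm subrr.
move/eqP: eqI; rewrite cone_map_eq0 => /IP[Tnm Tmn].
have [//|Tnd] := tot (n * d).
(* Modulo the support [n e = m d], so [n d e^2] agrees with [m e d^2], which is in [T]. As [- n d]
   is in [T] too, [n d e^2] lies in the support, and primality applies since [e] does not. *)
have Tdd : T (n * d * (e * e)).
  have -> : n * d * (e * e) = m * e * (d * d) + (n * e - m * d) * (d * e) by ring.
  apply: add; first by apply: mul => //; apply: sq.
  have [Tde|Tde] := tot (d * e); first exact: mul.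
  by rewrite -mulrNN; exact: mul.
have [_ _ _ prime] := coneT.
have Tdd' : T (- (n * d * (e * e))).
  by rewrite -mulNr; apply: mul => //; apply: sq.
have [[] //|[Tee Tee']] := prime _ _ Tdd Tdd'.
have : (e * e) \in I by apply/IP.
by move=> /primeI; rewrite orbb (negPf eI).
Qed.

Let le (x y : cone_field) := pos (y - x).
Let norm (x : cone_field) := if pos x then x else - x.

Let add_frac n d m e : d \notin I -> e \notin I ->
  cone_map n / cone_map d + cone_map m / cone_map e =
  cone_map (n * e + m * d) / cone_map (d * e).
Proof.
by move=> dI eI; rewrite rmorphD !rmorphM addf_div // cone_map_eq0.
Qed.

Let I_mul d e : d \notin I -> e \notin I -> d * e \notin I.
Proof. by move=> dI eI; apply/negP => /primeI; rewrite (negPf dI) (negPf eI). Qed.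

Let le0E x : le 0 x = pos x. Proof. by rewrite /le subr0. Qed.

Let pos_or x : pos x \/ pos (- x).
Proof.
have [n [d [dI ->]]] := cone_fieldP x; rewrite -mulNr -rmorphN !posE //.
have [Tnd|Tnd] := tot (n * d); first by left; apply/asboolP.
by right; apply/asboolP; rewrite mulNr.
Qed.

Let pos_anti x : pos x -> pos (- x) -> x = 0.
Proof.
have [n [d [dI ->]]] := cone_fieldP x; rewrite -mulNr -rmorphN !posE //.
move=> /asboolP Tnd /asboolP; rewrite mulNr => Tnd'.
have : n * d \in I by apply/IP.
move=> /primeI; rewrite (negPf dI) orbF -cone_map_eq0 => /eqP ->.
by rewrite mul0r.
Qed.

Let cone_le0_add x y : le 0 x -> le 0 y -> le 0 (x + y).
Proof.
have [n [d [dI ->]]] := cone_fieldP x; have [m [e [eI ->]]] := cone_fieldP y.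
rewrite add_frac // !le0E !posE ?I_mul // => /asboolP Tnd /asboolP Tme.
apply/asboolP.
have -> : (n * e + m * d) * (d * e) = n * d * (e * e) + m * e * (d * d) by ring.
by apply: add; apply: mul => //; apply: sq.
Qed.

Let cone_le0_mul x y : le 0 x -> le 0 y -> le 0 (x * y).
Proof.
have [n [d [dI ->]]] := cone_fieldP x; have [m [e [eI ->]]] := cone_fieldP y.
rewrite mulf_div -!rmorphM !le0E !posE ?I_mul // => /asboolP Tnd /asboolP Tme.
by apply/asboolP; rewrite mulrACA; apply: mul.
Qed.

Let cone_le0_anti x : le 0 x -> le x 0 -> x = 0.
Proof. by rewrite le0E /le sub0r; exact: pos_anti. Qed.

Let cone_sub_ge0 x y : le 0 (y - x) = le x y. Proof. by rewrite le0E. Qed.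

Let cone_le0_total x : le 0 x || le x 0.
Proof. by rewrite le0E /le sub0r; apply/orP; exact: pos_or. Qed.

Let cone_normN x : norm (- x) = norm x.
Proof.
rewrite /norm opprK; case: ifPn => px; case: ifPn => pnx //.
  by rewrite (pos_anti pnx px) oppr0.
by case: (pos_or x); rewrite ?(negPf px) ?(negPf pnx).
Qed.

Let cone_ge0_norm x : le 0 x -> norm x = x.
Proof. by rewrite le0E /norm => ->. Qed.

HB.instance Definition _ := Num.IntegralDomain_isLeReal.Build cone_field
  cone_le0_add cone_le0_mul cone_le0_anti cone_sub_ge0 cone_le0_total
  cone_normN cone_ge0_norm (fun _ _ => erefl).

Lemma cone_map_ge0 x : (0 <= cone_map x) = `[< T x >].
Proof.
have -> : (0 <= cone_map x) = pos (cone_map x) by rewrite -le0E.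
have I1 : 1 \notin I by rewrite -cone_map_eq0 rmorph1 oner_eq0.
by rewrite -[cone_map x]divr1 -(rmorph1 cone_map) posE // mulr1.
Qed.

End ConeField.

Lemma ex_real_field (B : comNzRingType) (T0 : set B) a :
  preordering T0 -> T0 a -> (forall k, ~ T0 (- a ^+ k)) ->
  exists (K : realFieldType) (h : {rmorphism B -> K}),
    (forall x, T0 x -> 0 <= h x) /\ 0 < h a.
Proof.
move=> T0P T0a nT0.
have [T [T0T coneT nTa]] := ex_total_prime_cone T0P T0a nT0.
exists (cone_field coneT), (cone_map coneT); split=> [x /T0T Tx|].
  by rewrite cone_map_ge0; apply/asboolP.
rewrite -[X in _ < X]opprK -rmorphN oppr_gt0 ltNge cone_map_ge0.
by apply/asboolP.
Qed.

(** * Ordered extensions with many roots *)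

Section AdjoinRoot.
Variable K : realFieldType.
Implicit Types p q f g h s : {poly K}.

(** The preordering of [K[X]] generated by the nonnegative constants; the weights [c] are there
    because these constants need not be squares in [K]. *)
Inductive wsos : {poly K} -> Prop :=
| WSos0 : wsos 0
| WSosS c h s of 0 <= c & wsos s : wsos (c *: h ^+ 2 + s).

Lemma wsosD s t : wsos s -> wsos t -> wsos (s + t).
Proof.
by elim=> [|c h s' c0 _ IH /IH tS]; rewrite ?add0r // -addrA; constructor.
Qed.

Lemma wsosZ c h s : 0 <= c -> wsos s -> wsos (c *: h ^+ 2 * s).
Proof.
move=> c0; elim=> [|d g t d0 _ IH]; first by rewrite mulr0; constructor.
rewrite mulrDr -scalerAl -scalerAr scalerA -exprMn.
by constructor => //; rewrite mulr_ge0.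
Qed.

Lemma wsosM s t : wsos s -> wsos t -> wsos (s * t).
Proof.
move=> sS tS; elim: sS => [|c h s' c0 _ IH]; first by rewrite mul0r; constructor.
by rewrite mulrDl; apply: wsosD => //; apply: wsosZ.
Qed.

Lemma wsos_sq h : wsos (h * h).
Proof.
rewrite -expr2 -[_ ^+ 2]addr0 -(scale1r (h ^+ 2)).
by constructor; [exact: ler01|constructor].
Qed.

Lemma wsosC c : 0 <= c -> wsos c%:P.
Proof.
move=> c0; rewrite -[c%:P]addr0 -[c%:P]mulr1 mul_polyC -(expr1n _ 2).
by constructor => //; constructor.
Qed.

Lemma wsos_ge0 s x : wsos s -> 0 <= s.[x].
Proof.
elim=> [|c h t c0 _ IH]; first by rewrite horner0.
by rewrite hornerD hornerZ horner_exp addr_ge0 // mulr_ge0 // sqr_ge0.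
Qed.

(** Each [h] is replaced by its remainder, of size at most [size f - 1]; its square has size at most
    [2 (size f - 1) - 1], the source of the constant 3. *)
Lemma wsos_mod f s : f != 0 -> wsos s -> exists s' g,
  [/\ wsos s', (size s' <= (size f).*2 - 3)%N & s = s' + f * g].
Proof.
move=> f0; elim=> [|c h t c0 _ [s' [g [s'S sz ->]]]].
  by exists 0, 0; split; [constructor|rewrite size_poly0|rewrite mulr0 addr0].
pose r := h %% f; pose q := h %/ f.
exists (c *: r ^+ 2 + s'), (c *: (q * (h + r)) + g); split.
- by constructor.
- rewrite (leq_trans (size_polyD _ _)) // geq_max sz andbT.
  rewrite (leq_trans (size_scale_leq _ _)) //.
  have [->|r0] := eqVneq r 0; first by rewrite expr0n /= size_poly0.
  rewrite expr2 size_mul //.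
  have : (size r < size f)%N by rewrite ltn_modp.
  by move: (size r) (size f) => [|m] [|n] //=; rewrite ?ltnS; lia.
- have {1}-> : h = q * f + r by exact: divp_eq.
  have -> : h = q * f + r by exact: divp_eq.
  rewrite -!mul_polyC; ring.
Qed.

(* If [-1 = s + f g] with [s] reduced modulo [f], then [g] also changes sign
   between [a] and [b], and it has smaller degree than [f]. *)
Lemma no_wsos f a b s g : f.[a] * f.[b] < 0 -> wsos s -> -1 != s + f * g.
Proof.
elim: {f}(size f) {-2}f (leqnn (size f)) s g => [|n IH] f szf s g.
  by move: szf; rewrite leqn0 size_poly_eq0 => /eqP ->; rewrite horner0 mul0r ltxx.
move=> fab sS; have f0 : f != 0.
  by apply: contraTneq fab => ->; rewrite horner0 mul0r ltxx.
apply/eqP => e; have [s' [g' [s'S szs' es]]] := wsos_mod f0 sS.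
have {}e : f * (g + g') = -1 - s' by move: e; rewrite es => ->; ring.
pose k := - (g + g').
have kE : f * k = 1 + s' by rewrite mulrN e; ring.
have pos x : 0 < (f * k).[x].
  by rewrite kE hornerD hornerC ltr_wpDr // wsos_ge0.
have kab : k.[a] * k.[b] < 0.
  have : 0 < (f * k).[a] * (f * k).[b] by rewrite mulr_gt0.
  rewrite !hornerM mulrACA => h; rewrite ltNge; apply/negP => k0.
  by have := lt_le_trans h (mulr_le0_ge0 (ltW fab) k0); rewrite ltxx.
have k0 : k != 0.
  by apply: contraTneq kab => ->; rewrite horner0 mul0r ltxx.
have szf2 : (1 < size f)%N.
  rewrite ltnNge; apply/negP => /size1_polyC fE.
  by move: fab; rewrite fE !hornerC -expr2 ltNge sqr_ge0.
have szk : (size k <= n)%N.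
  have : (size (f * k)%R <= maxn 1 ((size f).*2 - 3))%N.
    by rewrite kE (leq_trans (size_polyD _ _)) // size_poly1 geq_max leq_maxl
      leq_max szs' orbT.
  move: szf szf2; rewrite size_mul //; clear.
  by move: (size f) (size k) => u v; lia.
have := IH k szk s' (- f) kab s'S.
by apply/negP/negPn/eqP; rewrite mulrN mulrC kE; ring.
Qed.

(** The sign change takes the place of irreducibility: by [no_wsos] the weighted sums of squares
    modulo [f] omit [-1], so some ordered field receives [K[X]] with [f] sent to zero, and the image
    of [X] is a root. *)
Lemma adjoin_root f a b : f.[a] * f.[b] < 0 ->
  exists (L : realFieldType) (j : {rmorphism K -> L}) (y : L),
    (forall c, 0 <= c -> 0 <= j c) /\ root (map_poly j f) y.
Proof.
move=> fab; pose T0 : set {poly K} := fun p => exists s g, wsos s /\ p = s + f * g.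
have [|||L [h [hpos _]]] := @ex_real_field {poly K} T0 1.
- split=> [_ _ [s [g [sS ->]]] [t [k [tS ->]]]|
           _ _ [s [g [sS ->]]] [t [k [tS ->]]]|p].
  + by exists (s + t), (g + k); split; [exact: wsosD|ring].
  + by exists (s * t), (s * k + g * t + f * g * k); split; [exact: wsosM|ring].
  + by exists (p * p), 0; split; [exact: wsos_sq|ring].
- by exists 1, 0; split; [rewrite -[1]mulr1; exact: wsos_sq|ring].
- move=> k [s [g [sS]]]; rewrite expr1n => e.
  by have /eqP := no_wsos g fab sS; apply.
exists L, (h \o polyC), (h 'X); split=> [c c0|].
  by apply: hpos; exists c%:P, 0; split; [exact: wsosC|ring].
have hf : h f = 0.
  apply/eqP; rewrite eq_le -oppr_ge0 -rmorphN.
  by apply/andP; split; apply: hpos;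
    [exists 0, (-1)|exists 0, 1]; split; [constructor|ring|constructor|ring].
rewrite /root -hf; apply/eqP.
elim/poly_ind: (f) => [|p c IH]; first by rewrite !rmorph0 horner0.
rewrite [in LHS]rmorphD [in LHS]rmorphM /= map_polyX map_polyC.
by rewrite hornerD hornerM hornerX hornerC IH rmorphD rmorphM.
Qed.

End AdjoinRoot.

(** Divisors are included because Rolle's theorem applies the property to cofactors of [p], and
    because the property of a product then covers every factor. *)
Definition ivt_divisors (K : realFieldType) (p : {poly K}) :=
  forall d a b, d %| p -> a < b -> d.[a] * d.[b] < 0 ->
  exists c, [/\ a < c, c < b & root d c].

(** * Rolle's theorem from intermediate values of divisors *)

Section IntermediateValues.
Variable K : realFieldType.
Implicit Types p q d g : {poly K}.

Lemma mul_lt0_neq0 (x y : K) : x * y < 0 -> x != 0 /\ y != 0.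
Proof.
by move=> xy; split; apply: contraTneq xy => ->; rewrite ?mul0r ?mulr0 ltxx.
Qed.

(** A root [x] lies outside [[a, b]], so [X - x] has the same sign at [a] and [b]; dividing it out
    keeps the sign change. *)
Lemma rootless_divisor d a b : a < b -> d.[a] * d.[b] < 0 ->
  (forall c, a < c -> c < b -> ~~ root d c) ->
  exists e, [/\ e %| d, e.[a] * e.[b] < 0 & forall x, ~~ root e x].
Proof.
move=> ab; elim: {d}(size d) {-2}d (leqnn (size d)) => [|n IH] d szd dab nr.
  by move: szd dab; rewrite leqn0 size_poly_eq0 => /eqP ->; rewrite horner0
    mul0r ltxx.
have [[x rx]|nox] := pselect (exists x, root d x); last first.
  by exists d; split=> // x; apply/negP => rx; apply: nox; exists x.
have [da0 db0] := mul_lt0_neq0 dab.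
have /factor_theorem[e de] := rx.
have xab : 0 < (a - x) * (b - x).
  have xa : x != a by apply: contraNneq da0 => <-.
  have xb : x != b by apply: contraNneq db0 => <-.
  have [xlta|] := ltP x a; first by rewrite mulr_gt0 // subr_gt0 // (lt_trans xlta).
  rewrite le_eqVlt eq_sym (negPf xa) /= => ax.
  have [xltb|] := ltP x b; first by move: rx; rewrite (negPf (nr _ ax xltb)).
  rewrite le_eqVlt eq_sym (negPf xb) /= => bx.
  by rewrite -mulrNN mulr_gt0 // oppr_gt0 subr_lt0.
have eab : e.[a] * e.[b] < 0.
  by move: dab; rewrite de !hornerM !hornerXsubC mulrACA pmulr_llt0.
have e0 : e != 0 by apply: contraTneq eab => ->; rewrite horner0 mul0r ltxx.
have sze : (size e <= n)%N.
  by move: szd; rewrite de size_Mmonic ?monicXsubC // size_XsubC addn2.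
have [|f [fe fab nf]] := IH e sze eab.
  by move=> c ac cb; apply: contra (nr c ac cb); rewrite de rootM => ->.
by exists f; split=> //; rewrite de dvdp_mulr.
Qed.

Section Rolle.
Variables (p : {poly K}) (ivtp : ivt_divisors p) (ivtp' : ivt_divisors p^`()).
Hypothesis p0 : p != 0.

(* With [p = (X - a)^(m+1) (X - b)^(k+1) g], the cofactor of
   [(X - a)^m (X - b)^k] in the derivative changes sign between [a] and [b]. *)
Lemma rolle_consecutive a b : a < b -> root p a -> root p b ->
  (forall c, a < c -> c < b -> ~~ root p c) ->
  exists c, [/\ a < c, c < b & root p^`() c].
Proof.
move=> ab ra rb nr.
have [m [q qa pq]] := multiplicity_XsubC p a; rewrite p0 /= in qa.
have [k [g gb qg]] := multiplicity_XsubC q b.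
have q0 : q != 0 by apply: contraNneq qa => ->; rewrite root0.
rewrite q0 /= in gb.
have ga : ~~ root g a by apply: contra qa; rewrite qg rootM => ->.
case: m pq => [|m] pq; first by move: ra; rewrite pq expr0 mulr1 (negPf qa).
case: k qg => [|k] qg.
  move: rb; rewrite pq rootM qg expr0 mulr1 (negPf gb) /=.
  by rewrite root_exp_XsubC (gt_eqF ab).
rewrite {}qg in pq.
have gab : 0 < g.[a] * g.[b].
  rewrite lt_neqAle eq_sym mulf_neq0 //= leNgt; apply/negP => gab.
  have [|c [ac cb rc]] := ivtp _ ab gab; first by rewrite pq -mulrA dvdp_mulr.
  by move/negP: (nr c ac cb); apply; rewrite pq !rootM rc.
pose h := g^`() * ('X - a%:P) * ('X - b%:P) + g * ('X - a%:P) *+ k.+1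
          + g * ('X - b%:P) *+ m.+1.
have p'E : p^`() = h * (('X - a%:P) ^+ m * ('X - b%:P) ^+ k).
  rewrite pq !derivM !deriv_exp !derivB !derivX !derivC !subr0 !mul1r /= /h !exprS.
  by rewrite -[in LHS](mulr_natl _ k.+1) -[in LHS](mulr_natl _ m.+1) -[in
    RHS](mulr_natl _ k.+1) -[in RHS](mulr_natl _ m.+1); ring.
have hab : h.[a] * h.[b] < 0.
  rewrite /h !(hornerXsubC, hornerD, hornerM, hornerMn) !subrr !(mulr0, mul0r,
    mul0rn, add0r, addr0).
  rewrite mulrnAl mulrnAr -mulrnA pmulrn_llt0 //.
  have -> : g.[a] * (a - b) * (g.[b] * (b - a)) = - (g.[a] * g.[b] * (b - a) ^+ 2).
    by ring.
  by rewrite oppr_lt0 mulr_gt0 // exprn_gt0 // subr_gt0.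
have [|c [ac cb rc]] := ivtp' _ ab hab; first by rewrite p'E dvdp_mulr.
by exists c; split=> //; rewrite p'E rootM rc.
Qed.

Lemma rolle a b : a < b -> root p a -> root p b ->
  exists c, [/\ a < c, c < b & root p^`() c].
Proof.
move=> ab ra; pose inn b x := [&& root p x, a < x & x < b].
(* The induction is on a bound for the number of roots strictly between [a] and [b]; moving [b] to
   such a root [c] lowers it, since [c] is no longer counted. *)
have : forall rs, uniq rs -> all (inn b) rs -> (size rs <= size p)%N.
  move=> rs urs ars; rewrite ltnW // max_poly_roots //.
  by apply/allP => x /(allP ars)/and3P[].
elim: (size p) b ab => [|n IH] b ab small rb.
  apply: rolle_consecutive => // c ac cb; apply/negP => rc.
  by have := small [:: c] isT; rewrite /= /inn rc ac cb => /(_ isT).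
have [[c [ac cb rc]]|nc] := pselect (exists c, [/\ a < c, c < b & root p c]).
  have [|e [ae ec re]] := IH c ac _ rc; last by exists e; split=> //; exact:
    lt_trans cb.
  move=> rs urs ars; have := small (c :: rs); rewrite /= urs andbT; apply.
    by apply/negP => /(allP ars); rewrite /inn ltxx !andbF.
  rewrite /inn rc ac cb /=; apply/allP => x /(allP ars)/and3P[-> -> xc] /=.
  exact: lt_trans cb.
by apply: rolle_consecutive => // c ac cb; apply/negP => rc; apply: nc; exists c.
Qed.

Lemma deriv_rootless_inj a b x y : a <= x -> y <= b ->
  (forall c, a < c -> c < b -> ~~ root p^`() c) ->
  root p x -> root p y -> ~~ (x < y).
Proof.
move=> ax yb nr rx ry; apply/negP => xy; have [c [xc cy rc]] := rolle xy rx ry.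
by move: rc; apply/negP/nr; [exact: le_lt_trans xc|exact: lt_le_trans yb].
Qed.

(** A root [c] is simple, so the cofactor [g] of [X - c] changes sign and provides a second root
    [e]; Rolle's theorem between [c] and [e] gives a contradiction. *)
Lemma deriv_rootless_same_sign a b :
  (forall c, a < c -> c < b -> ~~ root p^`() c) -> 0 < p.[a] * p.[b] ->
  forall c, a < c -> c < b -> ~~ root p c.
Proof.
move=> nr pab c ac cb; apply/negP => rc; have /factor_theorem[g pg] := rc.
have p'c : p^`().[c] = g.[c].
  by rewrite pg derivM derivB derivX derivC subr0 !hornerE subrr mulr0 add0r.
have gc : ~~ root g c by rewrite /root -p'c; exact: nr.
have gab : g.[a] * g.[b] < 0.
  have := pab; rewrite pg !hornerM !hornerXsubC mulrACA => h.
  have : (a - c) * (b - c) < 0 by rewrite nmulr_rlt0 ?subr_gt0 // subr_lt0.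
  by move=> acb; rewrite -(nmulr_lgt0 _ acb).
have [|e [ae eb re]] := ivtp _ (lt_trans ac cb) gab; first by rewrite pg dvdp_mulr.
have ec : e != c by apply: contraNneq gc => <-.
have rpe : root p e by rewrite pg rootM re.
by case: (ltgtP e c) ec => // ec _; move: ec; apply/negP;
  apply: (deriv_rootless_inj _ _ nr) => //; exact: ltW.
Qed.

End Rolle.

End IntermediateValues.

Lemma rcf_ivt_divisors (R : rcfType) (p : {poly R}) : ivt_divisors p.
Proof.
move=> d a b _ ab dab; have [da0 db0] := mul_lt0_neq0 dab.
wlog da : d dab da0 db0 / d.[a] < 0.
  move=> wl; have [|] := ltP d.[a] 0; first exact: wl.
  rewrite le_eqVlt eq_sym (negPf da0) /= => da.
  have [||||c [ac cb rc]] := wl (- d); rewrite ?hornerN ?mulrNN ?oppr_eq0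
    ?oppr_lt0 //.
  by exists c; split=> //; rewrite -rootN.
have db : 0 < d.[b] by rewrite -(nmulr_rlt0 _ da).
have [|c /andP[ac cb] rc] := @poly_ivt R d a b (ltW ab).
  by rewrite (ltW da) ltW.
exists c; split=> //; rewrite lt_neqAle ?ac ?cb andbT.
  by apply: contraNneq da0 => ->.
by apply: contraNneq db0 => <-.
Qed.

(* Where the property fails, a divisor without roots changes sign, and
   adjoining one of its roots increases the number of roots of [p]. *)
Lemma ex_ivt_divisors (K : realFieldType) (p : {poly K}) : p != 0 ->
  exists (L : realFieldType) (j : {rmorphism K -> L}),
    (forall c, 0 <= c -> 0 <= j c) /\ ivt_divisors (map_poly j p).
Proof.
suff ind n (L : realFieldType) (q : {poly L}) rs : q != 0 -> uniq rs ->
    all (root q) rs -> (size q <= size rs + n)%N ->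
    exists (M : realFieldType) (j : {rmorphism L -> M}),
    (forall c, 0 <= c -> 0 <= j c) /\ ivt_divisors (map_poly j q).
  by move=> p0; apply: (ind (size p) K p [::]).
elim: n L q rs => [|n IH] L q rs q0 urs rrs szq.
  by have := max_poly_roots q0 rrs urs; rewrite ltnNge -(addn0 (size rs)) szq.
have [ivtq|nivt] := pselect (ivt_divisors q).
  by exists L, idfun; rewrite map_poly_id.
have [d [a [b [dq ab dab nr]]]] : exists d a b, [/\ d %| q, a < b,
    d.[a] * d.[b] < 0 & forall c, a < c -> c < b -> ~~ root d c].
  apply: contrapT => nex; apply: nivt => d a b dq ab dab.
  apply: contrapT => nc; apply: nex; exists d, a, b; split=> // c ac cb.
  by apply/negP => rc; apply: nc; exists c.
have [e [ed eab ne]] := rootless_divisor ab dab nr.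
have [M [j [y [jpos ry]]]] := adjoin_root eab.
have [|||| N [k [kpos ivtN]]] := IH M (map_poly j q) (y :: map j rs).
- by rewrite map_poly_eq0.
- rewrite /= map_inj_uniq ?urs ?andbT; last exact: fmorph_inj.
  apply/negP => /mapP[x _ yx]; move: ry; rewrite yx fmorph_root.
  by rewrite (negPf (ne x)).
- rewrite /= all_map; apply/andP; split.
    by apply: root_dvdp ry; rewrite dvdp_map (dvdp_trans ed).
  by apply/allP => x /(allP rrs) /= ; rewrite fmorph_root.
- by rewrite size_map_poly /= size_map addSnnS.
exists N, (k \o j); split=> [c /jpos/kpos //|].
by rewrite map_poly_comp.
Qed.

(** * Sign tables and the Artin-Lang principle *)

Section SignAtInfinity.
Variable K : realFieldType.
Implicit Types p : {poly K}.

Lemma horner_ge_pinfty p : 0 < lead_coef p ->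
  exists M e, 0 < e /\ forall x, M <= x -> e <= p.[x].
Proof.
elim/poly_ind: p => [|p c IH]; first by rewrite lead_coef0 ltxx.
have [->|p0] := eqVneq p 0.
  rewrite mul0r add0r lead_coefC => c0; exists 0, c; split=> // x _.
  by rewrite hornerC.
rewrite lead_coefDl ?lead_coefMX; last first.
  rewrite size_mulX // (leq_ltn_trans (size_polyC_leq1 c)) //.
  by rewrite ltnS lt0n size_poly_eq0.
(* Beyond this bound [p.[x] * x >= e * x >= e + |c|], so the same [e] serves for [p * 'X + c]. *)
move=> /IH[M [e [e0 Me]]]; exists (Num.max M (1 + `|c| / e)), e; split=> // x.
rewrite ge_max => /andP[/Me pe xe].
rewrite hornerMXaddC -lerBlDr.
have x0 : 0 <= x by rewrite (le_trans _ xe) // addr_ge0 // divr_ge0 // ltW.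
apply: le_trans (ler_wpM2r x0 pe).
apply: le_trans (ler_wpM2l (ltW e0) xe).
rewrite mulrDr mulr1 mulrCA divff ?gt_eqF // mulr1.
by rewrite lerD2l (le_trans (ler_norm _)) // normrN.
Qed.

Lemma sgr_horner_pinfty p : exists M, forall x, M <= x ->
  Num.sg p.[x] = Num.sg (lead_coef p).
Proof.
have [l0|l0|/eqP] := ltgtP (lead_coef p) 0; last first.
- rewrite lead_coef_eq0 => /eqP ->.
  by exists 0 => x _; rewrite horner0 lead_coef0.
- have [M [e [e0 Me]]] := horner_ge_pinfty l0.
  by exists M => x /Me; rewrite (gtr0_sg l0) => h; rewrite gtr0_sg //
    (lt_le_trans e0).
- have [|M [e [e0 Me]]] := @horner_ge_pinfty (- p).
    by rewrite lead_coefN oppr_gt0.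
  exists M => x /Me; rewrite (ltr0_sg l0) hornerN => h.
  by rewrite ltr0_sg // -oppr_gt0 (lt_le_trans e0).
Qed.

Lemma sgr_horner_infty (ps : seq {poly K}) : exists M, forall x, M <= x ->
  forall p, p \in ps -> Num.sg p.[x] = Num.sg (lead_coef p) /\
    Num.sg p.[- x] = Num.sg (lead_coef p) * (-1) ^+ (size p).-1.
Proof.
elim: ps => [|p ps [M HM]]; first by exists 0.
have [N HN] := sgr_horner_pinfty p.
have [N' HN'] := sgr_horner_pinfty (p \Po - 'X).
exists (Num.max M (Num.max N N')) => x; rewrite !ge_max => /and3P[Mx Nx N'x] q.
rewrite inE => /orP[/eqP ->|/(HM _ Mx)//]; split; first exact: HN.
have := HN' _ N'x; rewrite horner_comp hornerN hornerX => ->.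
rewrite lead_coef_comp ?size_polyN ?size_polyX //.
rewrite lead_coefN lead_coefX sgrM; congr (_ * _).
by rewrite sgrX sgrN1.
Qed.

End SignAtInfinity.

(** * Closure under truncation, derivation and remainder *)

Section PolyClosure.
Variable B : idomainType.
Implicit Types (p q r : {poly B}) (S : seq {poly B}).

(** Where the leading coefficient is mapped to zero, [p] and its truncation have the same image. *)
Definition poly_trunc p := take_poly (size p).-1 p.

Lemma size_poly_trunc p : p != 0 -> (size (poly_trunc p) < size p)%N.
Proof.
rewrite -size_poly_gt0 => p0.
by rewrite (leq_ltn_trans (size_take_poly _ _)) // prednK.
Qed.

(** The coefficients only form a domain, so [p %% q] is a pseudo-remainder: modulo [q] it equals [p]
    times a power of [lead_coef q]. *)
Definition poly_derived S := S ++ [seq poly_trunc p | p <- S] ++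
  [seq p^`() | p <- S] ++ [seq p %% q | p <- S, q <- S].

Variant poly_derived_spec S r : Prop :=
| DerivedId of r \in S
| DerivedTrunc p of p \in S & r = poly_trunc p
| DerivedDeriv p of p \in S & r = p^`()
| DerivedMod p q of p \in S & q \in S & r = p %% q.

Lemma poly_derivedP S r : reflect (poly_derived_spec S r) (r \in poly_derived S).
Proof.
rewrite !mem_cat; apply: (iffP or4P).
  case=> [|/mapP[p]|/mapP[p]|/allpairsP[[p q] [pS qS]]].
  - exact: DerivedId.
  - exact: DerivedTrunc.
  - exact: DerivedDeriv.
  - exact: DerivedMod pS qS.
case=> [rS|p pS ->|p pS ->|p q pS qS ->].
- by constructor 1.
- by constructor 2; apply: map_f.
- by constructor 3; apply: map_f.
- by constructor 4; apply/allpairsP; exists (p, q).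
Qed.

Definition poly_closed S := {subset poly_derived S <= S}.

(* The polynomials produced by derivation steps decrease in size, so the closure
   is reached after as many steps as the largest size. *)
Lemma ex_poly_closed S : exists S', {subset S <= S'} /\ poly_closed S'.
Proof.
suff ind k S1 : (forall r, r \in poly_derived S1 -> (k < size r)%N -> r \in S1) ->
    exists S', {subset S1 <= S'} /\ poly_closed S'.
  apply: (ind (\max_(r <- poly_derived S) size r)%N S) => r rS.
  by rewrite ltnNge (@leq_bigmax_seq _ _ xpredT (fun p : {poly B} => size p) r).
elim: k S1 => [|k IH] {}S HS.
  (* Every nonzero derived polynomial is already in [S] at this stage. *)
  exists (0 :: S); split=> [r rS|r rD]; first by rewrite inE rS orbT.
  have [->|r0] := eqVneq r 0; first by rewrite inE eqxx.
  rewrite inE (negPf r0) /=; have r0' : (0 < size r)%N by rewrite size_poly_gt0.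
  case/poly_derivedP: rD => [|p|p|p q]; rewrite ?inE ?(negPf r0) //=.
  - case/orP => [/eqP->|pS e]; last by apply: HS => //;
    apply/poly_derivedP/(DerivedTrunc pS).
    rewrite /poly_trunc linear0 => r00; by rewrite r00 eqxx in r0.
  - case/orP => [/eqP->|pS e]; last by apply: HS => //;
    apply/poly_derivedP/(DerivedDeriv pS).
    rewrite linear0 => r00; by rewrite r00 eqxx in r0.
  - case/orP => [/eqP->|pS]; first by rewrite mod0p => _ r00; rewrite r00 eqxx
    in r0.
    case/orP => [/eqP->|qS]; first by rewrite modp0 => ->.
    by move=> e; apply: HS => //; apply/poly_derivedP/(DerivedMod pS qS).
have big p : p \in poly_derived S -> (k.+1 < size p)%N -> p \in S by exact: HS.
have [r rDD kr|S' [DS' cS']] := IH (poly_derived S).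
  have r0 : r != 0 by rewrite -size_poly_gt0; exact: leq_trans kr.
  case/poly_derivedP: rDD => [//|p pD e|p pD e|p q pD qD e].
  - have p0 : p != 0 by apply: contraNneq r0 => p0; rewrite e p0 /poly_trunc
    linear0.
    apply/poly_derivedP/(DerivedTrunc _ e)/big => //.
    by rewrite (leq_ltn_trans kr) // e size_poly_trunc.
  - have p0 : p != 0 by apply: contraNneq r0 => p0; rewrite e p0 linear0.
    apply/poly_derivedP/(DerivedDeriv _ e)/big => //.
    by rewrite (leq_ltn_trans kr) // e lt_size_deriv.
  - have [q0|q0] := eqVneq q 0; first by rewrite e q0 modp0.
    have [pq|qp] := ltnP (size p) (size q); first by rewrite e modp_small.
    have rq : (size r < size q)%N by rewrite e ltn_modp.
    have kq := leq_ltn_trans kr rq.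
    by apply/poly_derivedP/(DerivedMod _ _ e); apply: big => //; apply:
      leq_trans qp.
exists S'; split=> // r rS; apply: DS'.
exact/poly_derivedP/DerivedId.
Qed.

End PolyClosure.

Section RootGaps.
Variable F : realFieldType.
Implicit Types (P : {poly F}) (a b c x y : F).

Lemma root_deriv_neq0 P a : P != 0 -> root P a -> P^`() != 0.
Proof.
move=> P0 ra; have szP := root_size_gt1 P0 ra.
apply/eqP => /polyP/(_ (size P).-2); rewrite coef_deriv coef0 => /eqP.
rewrite mulrn_eq0 /= prednK; last by move: szP; case: (size P) => [|[]].
by rewrite -lead_coefE lead_coef_eq0 (negPf P0).
Qed.

Lemma sgz_mul_ge0 x y : x != 0 -> y != 0 -> ~~ (x * y < 0) -> sgz x = sgz y.
Proof.
rewrite !neq_lt => /orP[hx|hx] /orP[hy|hy].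
- by rewrite !ltr0_sgz.
- by rewrite nmulr_rlt0 ?hy.
- by rewrite pmulr_rlt0 ?hy.
- by rewrite !gtr0_sgz.
Qed.

(** By Rolle's theorem the endpoints are not both roots, and a nonzero endpoint has the sign of the
    whole gap. The sign inside is thus a function of the signs at the ends. *)
Lemma gap_sgz P a b c : P != 0 -> ivt_divisors P ->
  (P^`() != 0 -> ivt_divisors P^`()) -> a < c -> c < b ->
  (forall e, a < e -> e < b -> ~~ root P e) ->
  (P^`() != 0 -> forall e, a < e -> e < b -> ~~ root P^`() e) ->
  sgz P.[c] = if P.[a] == 0 then sgz P.[b] else sgz P.[a].
Proof.
move=> P0 ivtP ivtP' ac cb nr nr'; have Pc : P.[c] != 0 by exact: nr.
case: eqVneq => [Pa|Pa]; last first.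
  apply/esym/sgz_mul_ge0 => //; apply/negP => /(ivtP _ _ _ (dvdpp P) ac).
  by case=> e [ae ec re]; move: (nr e ae (lt_trans ec cb)); rewrite re.
have [Pb|Pb] := eqVneq P.[b] 0.
  have P'0 : P^`() != 0 by apply: (@root_deriv_neq0 _ a) => //; apply/eqP.
  have [||e [ae eb re]] := rolle ivtP (ivtP' P'0) P0 (lt_trans ac cb).
  - exact/eqP.
  - exact/eqP.
  - by have := nr' P'0 e ae eb; rewrite re.
apply/sgz_mul_ge0 => //; apply/negP => /(ivtP _ _ _ (dvdpp P) cb).
by case=> e [ce eb re]; move: (nr e (lt_trans ac ce) eb); rewrite re.
Qed.

(** Rolle's theorem leaves at most one root of [P] in [[a, b]], and the endpoint signs decide
    whether there is an interior one. The criterion refers to these signs alone, so it gives the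
    same answer over two fields. *)
Lemma gap_split P a b : P != 0 -> ivt_divisors P ->
  (P^`() != 0 -> ivt_divisors P^`()) -> a < b ->
  (P^`() != 0 -> forall e, a < e -> e < b -> ~~ root P^`() e) ->
  if P.[a] * P.[b] < 0 then exists c, [/\ a < c, c < b, root P c,
    forall e, a < e -> e < c -> ~~ root P e &
    forall e, c < e -> e < b -> ~~ root P e]
  else forall e, a < e -> e < b -> ~~ root P e.
Proof.
move=> P0 ivtP ivtP' ab nr'.
have uniq x y : a <= x -> y <= b -> root P x -> root P y -> ~~ (x < y).
  move=> ax yb rx ry; have P'0 := root_deriv_neq0 P0 rx.
  exact: (deriv_rootless_inj ivtP (ivtP' P'0) P0 ax yb (nr' P'0) rx ry).
case: ifPn => Pab.
  have [c [ac cb rc]] := ivtP _ _ _ (dvdpp P) ab Pab.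
  exists c; split=> // e h1 h2; apply/negP => re.
    by have := uniq e c (ltW h1) (ltW cb) re rc; rewrite h2.
  by have := uniq c e (ltW ac) (ltW h2) rc re; rewrite h1.
move=> e ae eb; apply/negP => re; have P'0 := root_deriv_neq0 P0 re.
have [Pa|Pa] := eqVneq P.[a] 0.
  by have := uniq a e (lexx a) (ltW eb) _ re; rewrite ae => /(_ (introT eqP Pa)).
have [Pb|Pb] := eqVneq P.[b] 0.
  by have := uniq e b (ltW ae) (lexx b) re; rewrite eb => /(_ (introT eqP Pb)).
have Pab' : 0 < P.[a] * P.[b] by rewrite lt_neqAle eq_sym mulf_neq0 //= leNgt.
have := deriv_rootless_same_sign ivtP (ivtP' P'0) P0 (nr' P'0) Pab' ae eb.
by rewrite re.
Qed.

End RootGaps.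

(** * Sign tables built over two ordered fields in parallel *)

Section SignTable.
Variables (B : idomainType) (K L : realFieldType).
Variables (phi : {rmorphism B -> K}) (psi : {rmorphism B -> L}).
Implicit Types (p q r : {poly B}) (x y z : K * L) (l : seq (K * L)).
Local Notation "p ^1" := (map_poly phi p) (at level 2, format "p ^1").
Local Notation "p ^2" := (map_poly psi p) (at level 2, format "p ^2").

Variable S : seq {poly B}.
Hypothesis closedS : poly_closed S.
Hypothesis ivt1 : forall p, p \in S -> p^1 != 0 -> ivt_divisors p^1.
Hypothesis ivt2 : forall p, p \in S -> p^2 != 0 -> ivt_divisors p^2.
Hypothesis sgz_lead : forall p, p \in S ->
  sgz (phi (lead_coef p)) = sgz (psi (lead_coef p)).

Let same p z := sgz p^1.[z.1] = sgz p^2.[z.2].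
Let lt2 x y := x.1 < y.1 /\ x.2 < y.2.
(** The guards set aside polynomials whose image is zero: such an image has roots everywhere, but
    its sign is known. *)
Let rootless p x y :=
  (p^1 != 0 -> forall c, x.1 < c -> c < y.1 -> ~~ root p^1 c) /\
  (p^2 != 0 -> forall c, x.2 < c -> c < y.2 -> ~~ root p^2 c).

Let truncS p : p \in S -> poly_trunc p \in S.
Proof. by move=> pS; apply/closedS/poly_derivedP/(DerivedTrunc pS). Qed.
Let derivS p : p \in S -> p^`() \in S.
Proof. by move=> pS; apply/closedS/poly_derivedP/(DerivedDeriv pS). Qed.
Let modS p q : p \in S -> q \in S -> p %% q \in S.
Proof. by move=> pS qS; apply/closedS/poly_derivedP/(DerivedMod pS qS). Qed.

Lemma map_poly_trunc (F : fieldType) (f : {rmorphism B -> F}) p :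
  f (lead_coef p) = 0 -> map_poly f p = map_poly f (poly_trunc p).
Proof.
move=> fl; apply/polyP => i; rewrite !coef_map coef_take_poly.
case: ltnP => [_|szi]; first by [].
rewrite raddf0.
have [->|isz] := eqVneq i (size p).-1; first by rewrite -lead_coefE.
rewrite nth_default ?raddf0 //.
by move: szi isz; case: (size p) => //= n; lia.
Qed.

Let lead_eq0 p : p \in S -> (phi (lead_coef p) == 0) = (psi (lead_coef p) == 0).
Proof. by move=> pS; rewrite -sgz_eq0 sgz_lead // sgz_eq0. Qed.

Lemma map_poly_lead_neq0 (F : fieldType) (f : {rmorphism B -> F}) p :
  f (lead_coef p) != 0 -> map_poly f p != 0.
Proof.
move=> fl; apply: contraNneq fl => /polyP/(_ (size p).-1).
by rewrite coef_map coef0 -lead_coefE => ->.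
Qed.

Let ivtS1 p : p \in S -> p^1^`() != 0 -> ivt_divisors p^1^`().
Proof. by move=> pS; rewrite deriv_map; apply/ivt1/derivS. Qed.
Let ivtS2 p : p \in S -> p^2^`() != 0 -> ivt_divisors p^2^`().
Proof. by move=> pS; rewrite deriv_map; apply/ivt2/derivS. Qed.

(** The leading coefficient vanishes in both fields or in neither. If it does, [q] is replaced by
    its truncation; otherwise [gap_sgz] reads the sign at [z] from the equal signs at [x] and
    [y]. *)
Let gap_same (T : seq {poly B}) x y z : {subset T <= S} ->
  (forall q, q \in T -> poly_trunc q \in T /\ q^`() \in T) ->
  (forall q, q \in T -> [/\ rootless q x y, same q x & same q y]) ->
  lt2 x z -> lt2 z y -> forall q, q \in T -> same q z.
Proof.
move=> TS cT HT [xz1 xz2] [zy1 zy2] q.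
elim: {q}(size q) {-2}q (leqnn (size q)) => [|n IH] q szq qT.
  by move: szq; rewrite leqn0 size_poly_eq0 /same => /eqP ->; rewrite !rmorph0
    !horner0 !sgz0.
have [q0|q0] := eqVneq q 0; first by rewrite /same q0 !rmorph0 !horner0 !sgz0.
have qS := TS _ qT; have [tT dT] := cT _ qT.
have [fl|fl] := eqVneq (phi (lead_coef q)) 0.
  have gl : psi (lead_coef q) = 0 by apply/eqP; rewrite -lead_eq0 // fl.
  rewrite /same (map_poly_trunc fl) (map_poly_trunc gl); apply: IH => //.
  by rewrite -ltnS (leq_trans (size_poly_trunc q0)).
have gl : psi (lead_coef q) != 0 by rewrite -lead_eq0.
have q1 := map_poly_lead_neq0 fl; have q2 := map_poly_lead_neq0 gl.
have [[r1 r2] sx sy] := HT _ qT; have [[d1 d2] _ _] := HT _ dT.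
rewrite /same (gap_sgz q1 (ivt1 qS q1) (ivtS1 qS) xz1 zy1 (r1 q1)); last first.
  by rewrite deriv_map.
rewrite (gap_sgz q2 (ivt2 qS q2) (ivtS2 qS) xz2 zy2 (r2 q2)); last first.
  by rewrite deriv_map.
by rewrite -sgz_eq0 sx sgz_eq0; case: ifP.
Qed.

Let insert_root p x y : p \in S -> phi (lead_coef p) != 0 -> lt2 x y ->
  same p x -> same p y -> rootless p^`() x y ->
  rootless p x y \/ exists z, [/\ lt2 x z, lt2 z y, root p^1 z.1 /\ root p^2 z.2,
    rootless p x z & rootless p z y].
Proof.
move=> pS fl [xy1 xy2] sx sy [d1 d2]; rewrite -!deriv_map in d1 d2.
have gl : psi (lead_coef p) != 0 by rewrite -lead_eq0.
have p1 := map_poly_lead_neq0 fl; have p2 := map_poly_lead_neq0 gl.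
have := gap_split p1 (ivt1 pS p1) (ivtS1 pS) xy1; move/(_ d1).
have := gap_split p2 (ivt2 pS p2) (ivtS2 pS) xy2; move/(_ d2).
rewrite -[p^1.[_] * _ < 0]sgz_lt0 -[p^2.[_] * _ < 0]sgz_lt0 !sgzM.
rewrite -sx -sy; case: ifP => _; last by left.
move=> [c2 [? ? ? ? ?]] [c1 [? ? ? ? ?]]; right; exists (c1, c2).
by split.
Qed.

Fixpoint sign_chain (T : seq {poly B}) x l : Prop :=
  if l is y :: l' then
    [/\ lt2 x y, forall p, p \in T -> rootless p x y & sign_chain T y l']
  else True.

Let sign_chain_sub (T T' : seq {poly B}) x l :
  (forall a b, (forall p, p \in T -> rootless p a b) ->
    forall p, p \in T' -> rootless p a b) ->
  sign_chain T x l -> sign_chain T' x l.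
Proof.
move=> TT'; elim: l x => //= y l IH x [xy gap ch].
by split=> //; [exact: TT'|exact: IH].
Qed.

(** The two sources of the sign of a new polynomial at a point of the table: its leading
    coefficient, at the ends, or its remainder by some [q] of the table that has a root there. *)
Let endpoint z := forall p, p \in S -> phi (lead_coef p) != 0 -> same p z.
Let anchored (T : seq {poly B}) z := exists q,
  [/\ q \in T, phi (lead_coef q) != 0, root q^1 z.1 & root q^2 z.2].

(** Since the derivative of [p] is in [T], every gap receives at most one root of [p]. At a new
    point [p] is zero and the signs of [T] come from [gap_same]. *)
Let insert_chain (T : seq {poly B}) p x l : {subset T <= S} -> p \in S ->
  (forall q, q \in T -> poly_trunc q \in T /\ q^`() \in T) ->
  p^`() \in T -> phi (lead_coef p) != 0 -> sign_chain T x l ->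
  (forall z, z \in x :: l -> forall q, q \in p :: T -> same q z) ->
  exists l', [/\ sign_chain (p :: T) x l', last x l' = last x l &
    forall z, z \in l' -> z \in l \/ anchored (p :: T) z /\
      forall q, q \in p :: T -> same q z].
Proof.
move=> TS pS cT dT fl; elim: l x => [|y l IH] x; first by move=> _ _; exists [::].
case=> xy gap ch sm.
have [|l' [ch' la' new']] := IH y ch.
  by move=> z zl; apply: sm; rewrite inE zl orbT.
have smx q : q \in p :: T -> same q x by apply: sm; rewrite mem_head.
have smy q : q \in p :: T -> same q y by apply: sm; rewrite !inE eqxx orbT.
have [|rl|[z [xz zy [rz1 rz2] rxz rzy]]] := insert_root pS fl xy (smx _
  (mem_head _ _)) (smy _ (mem_head _ _)).
- exact: gap.
- exists (y :: l'); split=> //=; first split=> // q.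
    by rewrite inE => /orP[/eqP->//|/gap].
  move=> z; rewrite inE => /orP[/eqP ->|/new'[zl|]]; first by left; rewrite
    mem_head.
    by left; rewrite inE zl orbT.
  by right.
have sub_l : forall q, rootless q x y -> rootless q x z.
  move=> q [h1 h2]; case: zy => zy1 zy2; split=> q0 c xc cz; [apply: h1|apply:
    h2] => //.
    exact: lt_trans zy1.
  exact: lt_trans zy2.
have sub_r : forall q, rootless q x y -> rootless q z y.
  move=> q [h1 h2]; case: xz => xz1 xz2; split=> q0 c zc cy; [apply: h1|apply:
    h2] => //.
    exact: lt_trans zc.
  exact: lt_trans zc.
exists (z :: y :: l'); split=> //=.
  split=> // [q|].
    by rewrite inE => /orP[/eqP->//|/gap/sub_l].
  by split=> // q; rewrite inE => /orP[/eqP->//|/gap/sub_r].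
move=> w; rewrite !inE => /or3P[/eqP ->|/eqP ->|/new'[wl|]]; last first.
- by right.
- by left; rewrite wl orbT.
- by left; rewrite eqxx.
right; split; first by exists p; rewrite mem_head.
move=> q; rewrite inE => /orP[/eqP ->|qT].
  by rewrite /same (rootP rz1) (rootP rz2) !sgz0.
apply: (gap_same TS cT _ xz zy qT) => {}q {}qT.
by split; [exact: gap|apply: smx|apply: smy]; rewrite inE qT orbT.
Qed.

(** At a root of [q], the value of [p %% q] is that of [p] times a power of the leading coefficient
    of [q], and both the remainder and this coefficient have matching signs in the two fields. *)
Let anchored_same (T : seq {poly B}) p z : {subset T <= S} -> p \in S ->
  (forall q, q \in T -> phi (lead_coef q) != 0 -> p %% q \in T) ->
  (forall q, q \in T -> same q z) -> anchored T z -> same p z.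
Proof.
move=> TS pS mT sm [q [qT fl r1 r2]].
have sr := sm _ (mT _ qT fl); have qS := TS _ qT.
have gl : psi (lead_coef q) != 0 by rewrite -lead_eq0.
have eqp (F : fieldType) (f : {rmorphism B -> F}) c : root (map_poly f q) c ->
    f (lead_coef q) ^+ scalp p q * (map_poly f p).[c] = (map_poly f (p %% q)).[c].
  move=> rc; have := congr1 (fun r => (map_poly f r).[c]) (Pdiv.Idomain.divp_eq
    p q).
  rewrite -mul_polyC rmorphD !rmorphM /= map_polyC hornerD !hornerM hornerC.
  by rewrite (rootP rc) mulr0 add0r /= rmorphXn.
have := sr; rewrite /same -(eqp _ _ _ r1) -(eqp _ _ _ r2) !sgzM !sgzX (sgz_lead qS).
by apply: mulfI; rewrite expf_neq0 // sgz_eq0.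
Qed.

(** [T] is sorted by decreasing size. When a nonzero head [p] is inserted, the tail already holds
    its truncation, its derivative and its remainders by the tail, as members of [S] smaller than
    [p]. *)
Let ex_table x y (T : seq {poly B}) : lt2 x y -> endpoint x -> endpoint y ->
  {subset T <= S} -> pairwise (fun p q : {poly B} => size q <= size p)%N T ->
  (forall p q, p \in T -> q \in S -> (size q < size p)%N -> q \in T) ->
  exists l, [/\ sign_chain T x l, last x l = y &
    forall z, z \in x :: l -> (endpoint z \/ anchored T z) /\
      forall p, p \in T -> same p z].
Proof.
move=> xy ex ey; elim: T => [|p T IH] TS.
  move=> _ _; exists [:: y]; split=> // z; rewrite !inE => /orP[]/eqP ->.
    by split; [left|].
  by split; [left|].
rewrite pairwise_cons => /andP[/allP sorted_p sortedT] down.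
have pS : p \in S by rewrite TS ?mem_head.
have TS' : {subset T <= S} by move=> q qT; rewrite TS // inE qT orbT.
have inT q : q \in S -> (size q < size p)%N -> q \in T.
  move=> qS szq; have := down p q (mem_head _ _) qS szq.
  by rewrite inE => /orP[/eqP qp|//]; rewrite qp ltnn in szq.
have down' q r : q \in T -> r \in S -> (size r < size q)%N -> r \in T.
  by move=> qT rS szr; rewrite inT // (leq_trans szr) // sorted_p.
have [l [ch la pts]] := IH TS' sortedT down'.
have [p0|p0] := eqVneq p 0.
  have sp z : same p z by rewrite /same p0 !rmorph0 !horner0 !sgz0.
  have rp a b : rootless p a b by split; rewrite p0 rmorph0 eqxx.
  exists l; split=> //.
    apply: sign_chain_sub ch => a b gap q.
    by rewrite inE => /orP[/eqP->//|/gap].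
  move=> z zl; have [ea sm] := pts z zl; split.
    case: ea => [|[q [qT ? ? ?]]]; first by left.
    by right; exists q; rewrite inE qT orbT.
  by move=> q; rewrite inE => /orP[/eqP->//|/sm].
have tT : poly_trunc p \in T by apply: inT; [exact: truncS|exact: size_poly_trunc].
have dT : p^`() \in T by apply: inT; [exact: derivS|exact: lt_size_deriv].
have [fl|fl] := eqVneq (phi (lead_coef p)) 0.
  have gl : psi (lead_coef p) = 0 by apply/eqP; rewrite -lead_eq0 // fl.
  have sp z : same (poly_trunc p) z -> same p z.
    by rewrite /same (map_poly_trunc fl) (map_poly_trunc gl).
  have rp a b : rootless (poly_trunc p) a b -> rootless p a b.
    by rewrite /rootless (map_poly_trunc fl) (map_poly_trunc gl).
  exists l; split=> //.
    apply: sign_chain_sub ch => a b gap q.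
    by rewrite inE => /orP[/eqP->|/gap//]; apply/rp/gap.
  move=> z zl; have [ea sm] := pts z zl; split.
    case: ea => [|[q [qT ? ? ?]]]; first by left.
    by right; exists q; rewrite inE qT orbT.
  by move=> q; rewrite inE => /orP[/eqP->|/sm//]; apply/sp/sm.
have cT q : q \in T -> poly_trunc q \in T /\ q^`() \in T.
  move=> qT; have qS := TS' _ qT.
  have [q0|q0] := eqVneq q 0.
    have -> : poly_trunc q = q by rewrite q0 /poly_trunc linear0.
    by rewrite qT q0 linear0 -q0.
  split; apply: (down' q) => //.
  - exact: truncS.
  - exact: size_poly_trunc.
  - exact: derivS.
  - exact: lt_size_deriv.
have mT q : q \in T -> phi (lead_coef q) != 0 -> p %% q \in T.
  move=> qT flq; have q0 : q != 0 by apply: contraNneq flq => ->; rewrite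
    lead_coef0 rmorph0.
  apply: inT; first by apply: modS => //; exact: TS'.
  by rewrite (leq_trans _ (sorted_p _ qT)) // ltn_modp.
have smp z : z \in x :: l -> forall q, q \in p :: T -> same q z.
  move=> zl; have [ea sm] := pts z zl.
  move=> q; rewrite inE => /orP[/eqP ->|/sm //].
  case: ea => [|an]; first exact.
  exact: (anchored_same TS' pS mT sm an).
have [l' [ch' la' new']] := insert_chain TS' pS cT dT fl ch smp.
exists l'; split=> //; first by rewrite la'.
have old z : z \in x :: l -> (endpoint z \/ anchored (p :: T) z) /\
    forall q, q \in p :: T -> same q z.
  move=> zl; split; last exact: smp.
  have [[ez|[q [qT ? ? ?]]] _] := pts z zl; first by left.
  by right; exists q; rewrite inE qT orbT.
move=> z; rewrite inE => /orP[/eqP ->|/new'[zl|[an sm]]].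
- by apply: old; rewrite mem_head.
- by apply: old; rewrite inE zl orbT.
- by split; [right|].
Qed.

Let chain_point x l (c : K) : sign_chain S x l ->
  (forall z, z \in x :: l -> forall p, p \in S -> same p z) ->
  x.1 < c -> c < (last x l).1 -> exists d, forall p, p \in S -> same p (c, d).
Proof.
elim: l x => [|y l IH] x /=.
  by move=> _ _ xc cx; have := lt_trans xc cx; rewrite ltxx.
move=> [xy gap ch] sm xc cl.
have smx q : q \in S -> same q x by apply/sm/mem_head.
have smy q : q \in S -> same q y by apply: (sm y); rewrite !inE eqxx orbT.
have [cy|yc|cy] := ltgtP c y.1; last 1 first.
- by exists y.2; rewrite cy -surjective_pairing.
(* Any point of the corresponding gap in [L] will do, for instance its midpoint. *)
- have [x2 y2] := midf_lt xy.2.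
  exists ((x.2 + y.2) / 2%:R).
  case: xy => [xy1 xy2]; apply: (@gap_same S x y).
  + by [].
  + by move=> q qS; split; [exact: truncS|exact: derivS].
  + by move=> q qS; split; [exact: gap|exact: smx|exact: smy].
  + by split.
  + by split.
- apply: IH yc cl => // z zl; apply: sm; by rewrite inE zl orbT.
Qed.

Lemma sign_transfer (c : K) :
  exists d, forall p, p \in S -> sgz p^1.[c] = sgz p^2.[d].
Proof.
have [M HM] := sgr_horner_infty [seq p^1 | p <- S].
have [N HN] := sgr_horner_infty [seq p^2 | p <- S].
(* [a] also exceeds [|c|], so that [c] lies between the ends of the table, and [b] is made positive
   so that [- b < b]. *)
pose a := Num.max M (`|c| + 1); pose b := Num.max N 1.
have Ma : M <= a by rewrite le_max lexx.
have Nb : N <= b by rewrite le_max lexx.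
have ca : `|c| < a by rewrite lt_max ltrDl ltr01 orbT.
have b0 : 0 < b by rewrite lt_max ltr01 orbT.
have lcf (F : fieldType) (f : {rmorphism B -> F}) p : f (lead_coef p) != 0 ->
  lead_coef (map_poly f p) = f (lead_coef p) /\ size (map_poly f p) = size p.
  by move=> fl; rewrite lead_coef_map_eq ?size_map_poly_id0.
have ep p : p \in S -> phi (lead_coef p) != 0 -> same p (a, b) /\ same p (- a, - b).
  move=> pS fl; have gl : psi (lead_coef p) != 0 by rewrite -lead_eq0.
  have [l1 s1] := lcf _ _ _ fl; have [l2 s2] := lcf _ _ _ gl.
  have [ea ea'] := HM a Ma _ (map_f _ pS).
  have [eb eb'] := HN b Nb _ (map_f _ pS).
  rewrite /same /= -!(sgz_sgr p^1.[_]) -!(sgz_sgr p^2.[_]) ea ea' eb eb'.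
  by rewrite l1 l2 s1 s2 !sgzM !sgzX !sgzN !sgz1 !sgz_sgr sgz_lead.
pose T := sort (fun p q : {poly B} => size q <= size p)%N S.
have memT : T =i S by move=> p; rewrite mem_sort.
have [|||||| l [ch la pts]] := @ex_table (- a, - b) (a, b) T.
- have a0 : 0 < a := le_lt_trans (normr_ge0 c) ca.
  by split; rewrite /= gtrN.
- by move=> p pS fl; case: (ep p pS fl).
- by move=> p pS fl; case: (ep p pS fl).
- by move=> p; rewrite memT.
- rewrite -sorted_pairwise; first by apply: sort_sorted => p q; exact: leq_total.
  by move=> p q r pq qr; exact: leq_trans qr pq.
- by move=> p q; rewrite !memT.
have chS : sign_chain S (- a, - b) l.
  by apply: sign_chain_sub ch => x y gap p; rewrite -memT; exact: gap.
have [|||d Hd] := @chain_point (- a, - b) l c chS.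
- by move=> z /pts[_ sm] p; rewrite -memT; exact: sm.
- by rewrite ltrNl (le_lt_trans _ ca) // -normrN ler_norm.
- by rewrite la (le_lt_trans _ ca) // ler_norm.
by exists d.
Qed.

End SignTable.

(** * The Artin-Lang principle *)

Lemma sgz_map (K L : realFieldType) (j : {rmorphism K -> L}) :
  (forall c, 0 <= c -> 0 <= j c) -> forall c, sgz (j c) = sgz c.
Proof.
move=> jpos c; have [c0|c0|->] := ltgtP c 0; last by rewrite rmorph0 !sgz0.
  rewrite !ltr0_sgz // lt_neqAle fmorph_eq0 lt_eqF //= -oppr_ge0 -rmorphN.
  by rewrite jpos // oppr_ge0 ltW.
by rewrite !gtr0_sgz // lt_neqAle eq_sym fmorph_eq0 gt_eqF //= jpos // ltW.
Qed.

(** The Artin-Lang property of the point [phi]: a finite system of sign conditions satisfied there,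
    equations included, has a real solution that fixes the constants. *)
Definition sign_dense (R : rcfType) (K : realFieldType) (B : idomainType)
    (iota : {rmorphism R -> B}) (phi : {rmorphism B -> K}) :=
  forall Q : seq B, exists psi : {rmorphism B -> R},
    (forall r, psi (iota r) = r) /\
    forall q, q \in Q -> sgz (phi q) = sgz (psi q).

Lemma sign_dense_poly (R : rcfType) (K : realFieldType) (B : idomainType)
    (iota : {rmorphism R -> B}) (phi : {rmorphism B -> K}) (y : K) :
  sign_dense iota phi ->
  sign_dense (polyC \o iota) (horner_eval y \o map_poly phi).
Proof.
move=> dense Q; have [S [QS closedS]] := ex_poly_closed Q.
(* One extension that works for the product works for all the nonzero images, since [ivt_divisors]
   passes to divisors. *)
pose P := \prod_(p <- S | map_poly phi p != 0) map_poly phi p.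
have P0 : P != 0 by rewrite prodf_seq_neq0; apply/allP => p _; exact/implyP.
have [L [j [jpos ivtP]]] := ex_ivt_divisors P0.
(* The coordinates already present are moved to the reals using the leading coefficients alone; the
   table then supplies the last coordinate [d]. *)
have [psi [psiK psiS]] := dense [seq lead_coef p | p <- S].
have [|p pS _||d Hd] := @sign_transfer B L R (j \o phi) psi S closedS _ _ _ (j y).
- move=> p pS; rewrite map_poly_comp map_poly_eq0 => p0 e a b ep.
  apply: ivtP; apply: dvdp_trans ep _.
  by rewrite dvdp_map /P (big_rem p pS) /= p0 dvdp_mulIl.
- exact: rcf_ivt_divisors.
- by move=> p pS; rewrite /= sgz_map // psiS // map_f.
exists (horner_eval d \o map_poly psi); split=> [r|q /QS qS].
  by rewrite /= /horner_eval map_polyC hornerC /= psiK.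
rewrite /= /horner_eval -(Hd q qS) map_poly_comp /= horner_map.
by rewrite sgz_map.
Qed.

(** A homomorphism out of a real closed field preserves the order, nonnegative elements being
    squares. *)
Lemma sign_dense_id (R : rcfType) (K : realFieldType) (k : {rmorphism R -> K}) :
  sign_dense idfun k.
Proof.
move=> Q; exists idfun; split=> // r _; rewrite sgz_map // => c c0.
by rewrite -(sqr_sqrtr c0) rmorphXn sqr_ge0.
Qed.

Lemma ex_sign_dense (R : rcfType) (K : realFieldType) (k : {rmorphism R -> K})
    (xs : seq K) :
  exists (B : idomainType) (iota : {rmorphism R -> B}) (phi : {rmorphism B -> K}),
    [/\ forall r, phi (iota r) = k r, sign_dense iota phi &
      forall x, x \in xs -> exists b, phi b = x].
Proof.
elim: xs => [|x xs [B [iota [phi [phiK dense gen]]]]].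
  by exists R, idfun, k; split=> //; exact: sign_dense_id.
exists {poly B}, (polyC \o iota), (horner_eval x \o map_poly phi); split.
- by move=> r; rewrite /= /horner_eval map_polyC hornerC /= phiK.
- exact: sign_dense_poly.
- move=> y; rewrite inE => /orP[/eqP ->|/gen[b <-]].
    by exists 'X; rewrite /= /horner_eval map_polyX hornerX.
  by exists b%:P; rewrite /= /horner_eval map_polyC hornerC.
Qed.

(** * Arithmetic in MV-algebras *)

Section MVArithmetic.
Variable T : mvType.
Implicit Types x y z w : T.
Local Open Scope mv_scope.
Local Notation "1" := (mv_neg mv_zero) : mv_scope.

Definition mv_le x y := x^* ⊕ y = 1.
(** In the envelope this is [x + y <= 1]: the truncated sum is the true one. It differs from lattice
    disjointness, [x ⊓ y = 0]. *)
Definition mv_disj x y := x ⊙ y = 0.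
Local Notation "x ≤ y" := (mv_le x y) (at level 70).

Lemma mv_add0l x : 0 ⊕ x = x.
Proof. by rewrite mv_addC mv_add0. Qed.

Lemma mv_addAC x y z : x ⊕ y ⊕ z = x ⊕ z ⊕ y.
Proof. by rewrite -!mv_addA (mv_addC y). Qed.

Lemma mv_addACA x y z w : x ⊕ y ⊕ (z ⊕ w) = x ⊕ z ⊕ (y ⊕ w).
Proof. by rewrite !mv_addA (mv_addAC x y z). Qed.

Lemma mv_negM x y : (x ⊙ y)^* = x^* ⊕ y^*.
Proof. by rewrite /mv_mul mv_negK. Qed.

Lemma mv_negD x y : (x ⊕ y)^* = x^* ⊙ y^*.
Proof. by rewrite /mv_mul !mv_negK. Qed.

Lemma mv_mulC x y : x ⊙ y = y ⊙ x.
Proof. by rewrite /mv_mul mv_addC. Qed.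

Lemma mv_mulA x y z : x ⊙ (y ⊙ z) = x ⊙ y ⊙ z.
Proof. by rewrite /mv_mul !mv_negK mv_addA. Qed.

Lemma mv_mul1 x : x ⊙ 1 = x.
Proof. by rewrite /mv_mul mv_negK mv_add0 mv_negK. Qed.

Lemma mv_mul0 x : x ⊙ 0 = 0.
Proof. by rewrite /mv_mul mv_add1 mv_negK. Qed.

Lemma mv_add1l x : 1 ⊕ x = 1.
Proof. by rewrite mv_addC mv_add1. Qed.

Lemma mv_addN x : x ⊕ x^* = 1.
Proof.
by rewrite mv_addC; have := mv_lukasiewicz x 1; rewrite !mv_add1 mv_negK mv_add0l.
Qed.

Lemma mv_mulN x : x ⊙ x^* = 0.
Proof. by rewrite /mv_mul mv_addN mv_negK. Qed.

Lemma mv_le_refl x : x ≤ x.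
Proof. by rewrite /mv_le mv_addC mv_addN. Qed.

Lemma mv_le_addr x y : x ≤ x ⊕ y.
Proof. by rewrite /mv_le mv_addA (mv_addC _ x) mv_addN mv_add1l. Qed.

Lemma mv_le_mulr x y : x ⊙ y ≤ x.
Proof. by rewrite /mv_le mv_negM mv_addC mv_addA mv_addN mv_add1l. Qed.

Lemma mv_le0 x : 0 ≤ x.
Proof. by rewrite /mv_le mv_add1l. Qed.

Lemma mv_le1 x : x ≤ 1.
Proof. by rewrite /mv_le mv_add1. Qed.

Lemma mv_subK x y : x ≤ y -> (y ⊙ x^*) ⊕ x = y.
Proof.
move=> xy; have := mv_lukasiewicz x y.
by rewrite xy mv_negK mv_add0l /mv_mul mv_negK => <-.
Qed.

Lemma mv_leE x y : x ≤ y -> exists w, y = x ⊕ w.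
Proof. by move=> /mv_subK <-; exists (y ⊙ x^*); rewrite mv_addC. Qed.

Lemma mv_le_anti x y : x ≤ y -> y ≤ x -> x = y.
Proof.
rewrite /mv_le => xy yx; have := mv_lukasiewicz x y.
by rewrite xy yx mv_negK !mv_add0l => ->.
Qed.

Lemma mv_leD x y z w : x ≤ y -> z ≤ w -> x ⊕ z ≤ y ⊕ w.
Proof.
by move=> /mv_leE[u ->] /mv_leE[v ->]; rewrite mv_addACA; exact: mv_le_addr.
Qed.

Lemma mv_leN x y : x ≤ y -> y^* ≤ x^*.
Proof. by rewrite /mv_le mv_negK mv_addC. Qed.

Lemma mv_leM x y z : x ≤ y -> x ⊙ z ≤ y ⊙ z.
Proof.
by move=> /mv_leN xy; apply: mv_leN; apply: mv_leD xy _; exact: mv_le_refl.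
Qed.

Lemma mv_le0_eq x : x ≤ 0 -> x = 0.
Proof. by move=> x0; apply: mv_le_anti => //; exact: mv_le0. Qed.

Lemma mv_ge1_eq x : 1 ≤ x -> x = 1.
Proof. by move=> x0; apply: mv_le_anti => //; exact: mv_le1. Qed.

Lemma mv_leP x y : x ≤ y <-> x ⊙ y^* = 0.
Proof.
by rewrite /mv_le /mv_mul mv_negK; split=> [->|<-]; rewrite mv_negK.
Qed.

Lemma mv_disjC x y : mv_disj x y -> mv_disj y x.
Proof. by rewrite /mv_disj mv_mulC. Qed.

Lemma mv_disj_le x y z : x ≤ y -> mv_disj y z -> mv_disj x z.
Proof.
by move=> xy yz; apply: mv_le0_eq; rewrite -yz; exact: mv_leM.
Qed.

Lemma mv_disj_le2 x y z w : x ≤ y -> z ≤ w -> mv_disj y w -> mv_disj x z.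
Proof.
move=> xy zw yw; apply: (mv_disj_le xy); apply: mv_disjC.
by apply: (mv_disj_le zw); apply: mv_disjC.
Qed.

Lemma mv_addK x z : mv_disj x z -> (x ⊕ z) ⊙ z^* = x.
Proof.
rewrite /mv_disj /mv_mul => /(congr1 (@mv_neg T)); rewrite !mv_negK => xz.
by have := mv_lukasiewicz x^* z; rewrite mv_negK (mv_addC z^*) xz mv_negK
  mv_add0l => ->; rewrite mv_negK.
Qed.

Lemma mv_le_add2r x y z : mv_disj x z -> mv_disj y z ->
  x ⊕ z ≤ y ⊕ z -> x ≤ y.
Proof.
by move=> xz yz le; rewrite -(mv_addK xz) -(mv_addK yz); exact: mv_leM.
Qed.

Lemma mv_disj_sub x y : mv_disj (x ⊙ y^*) y.
Proof. by rewrite /mv_disj -mv_mulA (mv_mulC _ y) mv_mulN mv_mul0. Qed.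

Lemma mv_meetC x y : x ⊓ y = y ⊓ x.
Proof.
have := mv_lukasiewicz x^* y^*; rewrite !mv_negK => e.
rewrite /mv_meet /mv_mul; congr mv_neg.
by rewrite (mv_addC x^* y) (mv_addC y^* x) (mv_addC x^*) (mv_addC y^*) e.
Qed.

Lemma mv_meet_lel x y : x ⊓ y ≤ x.
Proof. exact: mv_le_mulr. Qed.

Lemma mv_meet_ler x y : x ⊓ y ≤ y.
Proof. by rewrite mv_meetC; exact: mv_meet_lel. Qed.

Lemma mv_meet_l x y : x ≤ y -> x ⊓ y = x.
Proof. by rewrite /mv_meet => ->; rewrite mv_mul1. Qed.

Lemma mv_le_meet x y z : z ≤ x -> z ≤ y -> z ≤ x ⊓ y.
Proof.
move=> zx zy; rewrite -{1}(mv_meet_l zx) mv_meetC /mv_meet.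
rewrite mv_mulC (mv_mulC x); apply: mv_leM.
by apply: mv_leD zy; exact: mv_le_refl.
Qed.

Lemma mv_sub_meet x y : x ⊙ (x ⊓ y)^* = x ⊙ y^*.
Proof.
rewrite {1}/mv_meet mv_negM mv_negD mv_negK -/(mv_meet _ _) mv_meetC.
by rewrite mv_meet_l //; exact: mv_le_mulr.
Qed.

(** The meet [d] of the two differences, added to [x ⊓ y], stays below both [x] and [y], hence below
    [x ⊓ y]; cancellation makes [d] zero. *)
Lemma mv_sub_meet_disj x y : (x ⊙ y^*) ⊓ (y ⊙ x^*) = 0.
Proof.
set d := _ ⊓ _; pose m := x ⊓ y.
have dx : d ≤ x ⊙ m^* by rewrite mv_sub_meet; exact: mv_meet_lel.
have dy : d ≤ y ⊙ m^* by rewrite /m mv_meetC mv_sub_meet; exact: mv_meet_ler.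
have dm : mv_disj d m by apply: mv_disj_le dx _; exact: mv_disj_sub.
apply: mv_le0_eq; apply: (mv_le_add2r (z := m)) => //.
  by rewrite /mv_disj mv_mulC mv_mul0.
rewrite mv_add0l; apply: mv_le_meet.
  rewrite -[X in _ ≤ X](mv_subK (mv_meet_lel x y)).
  by apply: mv_leD => //; exact: mv_le_refl.
rewrite -[X in _ ≤ X](mv_subK (mv_meet_ler x y)).
by apply: mv_leD => //; exact: mv_le_refl.
Qed.

(** The part of [y] that fits beside [x] is [y ⊓ x^*]; what exceeds is [y ⊙ x], by [mv_overflow]. A
    truncated sum thus becomes one without overflow. *)
Lemma mv_addE x y : x ⊕ y = x ⊕ (y ⊓ x^*).
Proof.
rewrite mv_meetC /mv_meet mv_negK (mv_mulC _ (x ⊕ y)) (mv_addC x (_ ⊙ _)).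
by rewrite mv_subK //; exact: mv_le_addr.
Qed.

Lemma mv_overflow x y : y = (y ⊙ x) ⊕ (y ⊓ x^*).
Proof.
rewrite -{1}(mv_subK (mv_meet_lel y x^*)) mv_sub_meet mv_negK.
by [].
Qed.

Section Subtractive.
Variable f : T -> T.
Hypothesis fB : forall x y, y ≤ x -> f (x ⊙ y^*) = f x ⊙ (f y)^*.

Lemma subtractive0 : f 0 = 0.
Proof. by rewrite -(mv_mulN 0) fB ?mv_mulN //; exact: mv_le_refl. Qed.

Lemma subtractive_le x y : x ≤ y -> f x ≤ f y.
Proof.
move=> xy; have -> : x = y ⊙ (y ⊙ x^*)^*.
  have := mv_addK (mv_disjC (mv_disj_sub y x)).
  by rewrite mv_addC mv_subK.
by rewrite fB; exact: mv_le_mulr.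
Qed.

(** Products and scalar operations are axiomatised through differences; sums without overflow are
    recovered by subtracting [y] from [x ⊕ y]. *)
Lemma subtractiveD x y : mv_disj x y ->
  f (x ⊕ y) = f x ⊕ f y /\ mv_disj (f x) (f y).
Proof.
move=> xy; have yxy : y ≤ x ⊕ y by rewrite mv_addC; exact: mv_le_addr.
have := fB yxy; rewrite mv_addK // => fx.
split; last by rewrite fx; exact: mv_disj_sub.
by rewrite fx mv_subK //; exact: subtractive_le.
Qed.

End Subtractive.

End MVArithmetic.

Section PMVfArithmetic.
Variable T : pmvfType.
Implicit Types x y z : T.
Local Open Scope mv_scope.

Lemma pmv_mul_sub z x y : mv_le y x -> z ⋅ (x ⊙ y^*) = z ⋅ x ⊙ (z ⋅ y)^*.
Proof.
move=> yx; have := pmv_mulBr z x y.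
by rewrite (mv_meetC x) mv_meet_l.
Qed.

Lemma pmv_sub_mul z x y : mv_le y x -> (x ⊙ y^*) ⋅ z = x ⋅ z ⊙ (y ⋅ z)^*.
Proof.
move=> yx; have := pmv_mulBl z x y.
by rewrite (mv_meetC x) mv_meet_l.
Qed.

Lemma pmv_mulDr z x y : mv_disj x y ->
  z ⋅ (x ⊕ y) = z ⋅ x ⊕ z ⋅ y /\ mv_disj (z ⋅ x) (z ⋅ y).
Proof. by apply: (subtractiveD (f := pmv_mul z)) => {}x {}y; exact: pmv_mul_sub.
  Qed.

Lemma pmv_mulDl z x y : mv_disj x y ->
  (x ⊕ y) ⋅ z = x ⋅ z ⊕ y ⋅ z /\ mv_disj (x ⋅ z) (y ⋅ z).
Proof.
by apply: (subtractiveD (f := fun x => x ⋅ z)) => {}x {}y; exact: pmv_sub_mul.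
Qed.

Lemma pmv_le_mul z x y : mv_le x y -> mv_le (x ⋅ z) (y ⋅ z).
Proof.
by apply: (subtractive_le (f := fun x => x ⋅ z)) => {}x {}y; exact: pmv_sub_mul.
Qed.

Lemma pmv_mul0 z : z ⋅ 0 = 0.
Proof. by apply: (subtractive0 (f := pmv_mul z)) => x y; exact: pmv_mul_sub. Qed.

Lemma pmv_mul0l z : 0 ⋅ z = 0.
Proof.
by apply: (subtractive0 (f := fun x => x ⋅ z)) => x y; exact: pmv_sub_mul.
Qed.

(** Multiplying one side of the meet by [y] and then the other by [x] turns both into [x ⋅ y]. *)
Lemma pmv_mul_meet0 x y : x ⊓ y = 0 -> x ⋅ y = 0.
Proof.
move=> /(@pmv_fl _ _ _ y); rewrite mv_meetC => /(@pmv_fr _ _ _ x).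
by rewrite mv_meet_l //; exact: mv_le_refl.
Qed.

End PMVfArithmetic.

Section RieszArithmetic.
Variables (R : realType) (T : rieszMVType R).
Implicit Types (x y z : T) (r s : R).
Local Open Scope mv_scope.

Lemma clip_ge0 r : (0 <= Num.max 0 (Num.min 1 r))%R.
Proof. by rewrite le_max lexx. Qed.
Lemma clip_le1 r : (Num.max 0 (Num.min 1 r) <= 1)%R.
Proof. by rewrite ge_max ler01 ge_min lexx. Qed.

(** Clipping extends the scalars to all reals; negative ones act as 0, which is how [leval] selects
    a positive part. *)
Definition clip r : {i01 R} := Itv01 (clip_ge0 r) (clip_le1 r).

Lemma clip_num r : (0 <= r)%R -> (r <= 1)%R -> (clip r)%:num%R = r.
Proof. by move=> r0 r1 /=; rewrite min_r // max_r. Qed.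

Definition rscale r x : T := clip r ⊡ x.

Lemma rscale_num (a : {i01 R}) x : rscale a%:num%R x = a ⊡ x.
Proof. by congr (_ ⊡ _); apply: val_inj; apply: clip_num; rewrite ?ge0 ?le1. Qed.

Lemma rscaleE r x (r0 : (0 <= r)%R) (r1 : (r <= 1)%R) : rscale r x = Itv01 r0 r1
  ⊡ x.
Proof. by rewrite -rscale_num. Qed.

Lemma rscale_sub r x y : mv_le y x -> rscale r (x ⊙ y^*) = rscale r x ⊙ (rscale
  r y)^*.
Proof. by move=> _; exact: mv_scaleBr. Qed.

Lemma rscale0r r : rscale r 0 = 0.
Proof. exact: subtractive0 (@rscale_sub r). Qed.

Lemma rscale_le r x y : mv_le x y -> mv_le (rscale r x) (rscale r y).
Proof. exact: subtractive_le (@rscale_sub r) _ _. Qed.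

Lemma rscaleDr r x y : mv_disj x y ->
  rscale r (x ⊕ y) = rscale r x ⊕ rscale r y /\ mv_disj (rscale r x) (rscale r y).
Proof. exact: subtractiveD (@rscale_sub r) _ _. Qed.

Lemma rscaleB r s x : (0 <= s)%R -> (s <= r)%R -> (r <= 1)%R ->
  rscale (r - s) x = rscale r x ⊙ (rscale s x)^*.
Proof.
move=> s0 sr r1; have r0 := le_trans s0 sr; have s1 := le_trans sr r1.
rewrite (rscaleE _ r0 r1) (rscaleE _ s0 s1) -mv_scaleBl -rscale_num.
by congr rscale; rewrite /= max_r // subr_ge0.
Qed.

Lemma rscale0 x : rscale 0 x = 0.
Proof. by rewrite -(subrr 0%R) rscaleB ?mv_mulN. Qed.

Lemma rscale1 x : rscale 1 x = x.
Proof. by rewrite -[RHS](mv_scale1 (R := R)) -rscale_num. Qed.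

Lemma rscale_ler r s x : (0 <= s)%R -> (s <= r)%R -> (r <= 1)%R ->
  mv_le (rscale s x) (rscale r x).
Proof.
move=> s0 sr r1; have -> : s = (r - (r - s))%R by rewrite subKr.
by rewrite rscaleB ?subr_ge0 ?lerBlDr ?lerDl //; exact: mv_le_mulr.
Qed.

Lemma rscaleDl r s x : (0 <= r)%R -> (0 <= s)%R -> (r + s <= 1)%R ->
  rscale (r + s) x = rscale r x ⊕ rscale s x /\ mv_disj (rscale r x) (rscale s x).
Proof.
move=> r0 s0 rs1; have srs : (s <= r + s)%R by rewrite lerDr.
have rE : rscale r x = rscale (r + s) x ⊙ (rscale s x)^*.
  by rewrite -rscaleB // addrK.
split; last by rewrite rE; exact: mv_disj_sub.
by rewrite rE mv_subK //; exact: rscale_ler.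
Qed.

Lemma rscaleA r s x : (0 <= r)%R -> (r <= 1)%R -> (0 <= s)%R -> (s <= 1)%R ->
  rscale r (rscale s x) = rscale (r * s) x.
Proof.
move=> r0 r1 s0 s1; rewrite (rscaleE x s0 s1) (rscaleE _ r0 r1) mv_scaleA.
by rewrite -rscale_num.
Qed.

(** Scaling [x] by [min(1, n r)] gives zero for every [n], as each step adds at most [r]; the reals
    being archimedean, [n r] reaches 1. *)
Lemma rscale_eq0 r x : (0 < r)%R -> (r <= 1)%R -> rscale r x = 0 -> x = 0.
Proof.
move=> r0 r1 rx.
have iter n : rscale (Num.min 1 (r *+ n)) x = 0.
  elim: n => [|n IH]; first by rewrite mulr0n min_r // rscale0.
  pose m := (Num.min 1 (r *+ n))%R; pose M := (Num.min 1 (r *+ n.+1))%R.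
  have rn0 : (0 <= r *+ n)%R by rewrite mulrn_wge0 // ltW.
  have mM : (m <= M)%R.
    by rewrite /m /M le_min !ge_min lexx /= mulrSr lerDl (ltW r0) orbT.
  have m0 : (0 <= m)%R by rewrite le_min ler01.
  have M1 : (M <= 1)%R by rewrite ge_min lexx.
  have Mr : (M - m <= r)%R.
    rewrite lerBlDl /m /M; case: (lerP 1 (r *+ n)) => h.
      by rewrite ge_min lerDl (ltW r0).
    by rewrite ge_min mulrSr lexx orbT.
  have := @rscaleDl (M - m) m x; rewrite subrK subr_ge0 => /(_ mM m0 M1)[-> _].
  rewrite IH mv_add0; apply: mv_le0_eq; rewrite -rx.
  by apply: rscale_ler; rewrite ?subr_ge0.
have [n rn] : exists n, (1 <= r *+ n)%R.
  exists (Num.bound (r^-1)); rewrite -mulr_natr -ler_pdivrMl // mulr1.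
  by rewrite ltW // archi_boundP // invr_ge0 ltW.
by have := iter n; rewrite min_l // rscale1.
Qed.

Lemma rscale_le_cancel r x y : (0 < r)%R -> (r <= 1)%R ->
  mv_le (rscale r x) (rscale r y) -> mv_le x y.
Proof.
move=> r0 r1 /mv_leP h; apply/mv_leP; apply: (rscale_eq0 r0 r1).
by rewrite -h; exact: mv_scaleBr.
Qed.

End RieszArithmetic.

Section FRplusArithmetic.
Variables (R : realType) (A : frplusType R).
Implicit Types x y z : A.
Local Open Scope mv_scope.
Local Notation "1" := (mv_neg mv_zero) : mv_scope.

(** If [e] is the identity, then [1 ⋅ e = 1 = 1 ⋅ 1], so [1 ⋅ e^* = 0]; hence the square of [e^*] is
    zero and semiprimeness gives [e = 1]. *)
Lemma frp_mul1 x : x ⋅ 1 = x.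
Proof.
have [e eP] := @frp_unital R A.
have e1 : e ⋅ 1 = 1 :> A by have [] := eP 1.
have one1 : 1 ⋅ 1 = 1 :> A.
  by apply: mv_ge1_eq; rewrite -{1}e1; apply: pmv_le_mul; exact: mv_le1.
have ne : 1 ⋅ e^* = 0 :> A.
  have := pmv_mul_sub 1 (mv_le1 e); rewrite one1 (mv_mulC _ e^*) mv_mul1 => ->.
  by have [_ ->] := eP 1; rewrite mv_mulN.
have : e^* = 0.
  apply: (@frp_semiprime R A _ 2) => //=; apply: mv_le0_eq.
  by rewrite -ne; apply: pmv_le_mul; exact: mv_le1.
by move=> /(congr1 (@mv_neg A)); rewrite mv_negK => <-; have [] := eP x.
Qed.

Lemma rscaleAl r x y : rscale r (x ⋅ y) = rscale r x ⋅ y.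
Proof. exact: fmv_scaleAl. Qed.

Lemma rscaleAr r x y : rscale r (x ⋅ y) = x ⋅ rscale r y.
Proof. exact: fmv_scaleAr. Qed.

End FRplusArithmetic.

(** * The enveloping ring *)

HB.instance Definition _ (T : mvType) := Monoid.isComLaw.Build T mv_zero
  (@mv_add T) (@mv_addA T) (@mv_addC T) (@mv_add0l T).

Section SignedCombinations.
Variables (R : realType) (A : frplusType R).
Local Notation term := {classic R * A}.
Implicit Types (l m n : seq term) (p q : term) (x y z : A) (r s t : R).
Local Notation "a ⊕ b" := (mv_add a b).
Local Notation "a ⋅ b" := (pmv_mul a b).
Local Notation one := (mv_neg mv_zero : A).

Lemma rscale_neg r x : r <= 0 -> rscale r x = mv_zero.
Proof.
move=> r0; rewrite -[RHS](rscale0 (R := R) x) /rscale; congr mv_scale.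
by apply: val_inj => /=; rewrite !min_r ?ler01 ?(le_trans r0) // maxxx max_l.
Qed.

(* Only the nonnegative coefficients of [l] contribute: the value of the
   positive part of [t l]. *)
Definition leval t l : A := \big[@mv_add A/mv_zero]_(p <- l) rscale (t * p.1) p.2.
Definition lweight l : R := \sum_(p <- l) `|p.1|.
Definition lopp l := [seq (- p.1, p.2) | p <- l].
Definition lmul l m := [seq (p.1 * q.1, p.2 ⋅ q.2) | p <- l, q <- m].
(** Scaling by [t] makes all partial sums computable in [A] without overflow; there the positive
    part has to dominate the negative part. *)
Definition lpos l := exists t,
  [/\ 0 < t, t * lweight l <= 1 & mv_le (leval t (lopp l)) (leval t l)].

Lemma leval_cat t l m : leval t (l ++ m) = leval t l ⊕ leval t m.
Proof. by rewrite /leval big_cat. Qed.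
Lemma leval_cons t p l : leval t (p :: l) = rscale (t * p.1) p.2 ⊕ leval t l.
Proof. by rewrite /leval big_cons. Qed.
Lemma leval_nil t : leval t [::] = mv_zero.
Proof. by rewrite /leval big_nil. Qed.
Lemma leval_seq1 t p : leval t [:: p] = rscale (t * p.1) p.2.
Proof. by rewrite leval_cons leval_nil mv_add0. Qed.
Lemma leval_perm t l m : perm_eq l m -> leval t l = leval t m.
Proof. exact: perm_big. Qed.

Lemma lweight_cat l m : lweight (l ++ m) = lweight l + lweight m.
Proof. by rewrite /lweight big_cat. Qed.
Lemma lweight_cons p l : lweight (p :: l) = `|p.1| + lweight l.
Proof. by rewrite /lweight big_cons. Qed.
Lemma lweight_nil : lweight [::] = 0.
Proof. by rewrite /lweight big_nil. Qed.
Lemma lweight_ge0 l : 0 <= lweight l.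
Proof. by apply: sumr_ge0 => p _; exact: normr_ge0. Qed.
Lemma lweight_opp l : lweight (lopp l) = lweight l.
Proof. by rewrite /lweight big_map; apply: eq_bigr => p _; rewrite normrN. Qed.
Lemma lweight_perm l m : perm_eq l m -> lweight l = lweight m.
Proof. exact: perm_big. Qed.

Lemma lopp_cat l m : lopp (l ++ m) = lopp l ++ lopp m.
Proof. exact: map_cat. Qed.
Lemma loppK : involutive lopp.
Proof.
by move=> l; rewrite /lopp -map_comp map_id_in // => p _ /=; rewrite opprK
  -surjective_pairing.
Qed.

Lemma leval_le t l : 0 <= t -> t * lweight l <= 1 ->
  mv_le (leval t l) (rscale (t * lweight l) one).
Proof.
move=> t0; elim: l => [|p l IH]; first by rewrite leval_nil => _; exact: mv_le0.
rewrite leval_cons lweight_cons mulrDr => small.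
have tp0 : 0 <= t * `|p.1| by rewrite mulr_ge0.
have tl0 : 0 <= t * lweight l by rewrite mulr_ge0 // lweight_ge0.
have [-> _] := rscaleDl one tp0 tl0 small.
apply: mv_leD; last by apply: IH; rewrite (le_trans _ small) // lerDr.
have [p0|p0] := leP 0 p.1.
  by rewrite ger0_norm //; apply: rscale_le; exact: mv_le1.
by rewrite rscale_neg ?mulr_ge0_le0 ?(ltW p0) //; exact: mv_le0.
Qed.

Lemma leval_disj t l m : 0 <= t -> t * (lweight l + lweight m) <= 1 ->
  mv_disj (leval t l) (leval t m).
Proof.
rewrite mulrDr => t0 small.
have l0 : 0 <= t * lweight l by rewrite mulr_ge0 // lweight_ge0.
have m0 : 0 <= t * lweight m by rewrite mulr_ge0 // lweight_ge0.
have [_ d] := rscaleDl one l0 m0 small.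
apply: mv_disj_le2 d; apply: leval_le => //.
  by rewrite (le_trans _ small) // lerDl.
by rewrite (le_trans _ small) // lerDr.
Qed.

Lemma leval_disj_cons t p l : 0 <= t -> t * lweight (p :: l) <= 1 ->
  mv_disj (rscale (t * p.1) p.2) (leval t l).
Proof.
move=> t0 small; rewrite -leval_seq1; apply: leval_disj => //.
by rewrite -lweight_cat.
Qed.

Lemma small_cons t p l : 0 <= t -> t * lweight (p :: l) <= 1 -> t * lweight l <= 1.
Proof.
by move=> t0; apply: le_trans; rewrite ler_wpM2l // lweight_cons lerDr.
Qed.

Lemma small_head t p l : 0 <= t -> t * lweight (p :: l) <= 1 -> t * p.1 <= 1.
Proof.
move=> t0; apply: le_trans; rewrite ler_wpM2l // lweight_cons.
by rewrite (le_trans (ler_norm _)) // lerDl lweight_ge0.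
Qed.

Lemma rscale_leval s t l : 0 <= s -> s <= 1 -> 0 <= t -> t * lweight l <= 1 ->
  rscale s (leval t l) = leval (s * t) l.
Proof.
move=> s0 s1 t0; elim: l => [|p l IH] small; first by rewrite !leval_nil rscale0r.
have [e _] := rscaleDr s (leval_disj_cons t0 small).
rewrite !leval_cons e IH ?(small_cons t0 small) //; congr mv_add.
have [p0|p0] := leP 0 p.1.
  by rewrite rscaleA ?mulr_ge0 ?(small_head t0 small) // mulrA.
have tp : t * p.1 <= 0 := mulr_ge0_le0 t0 (ltW p0).
by rewrite [rscale (t * _) _]rscale_neg // rscale0r rscale_neg // -mulrA
  mulr_ge0_le0.
Qed.

(** The scale is immaterial: [s] and [t] are compared through their minimum [u], going down by
    monotonicity of scaling and up by its cancellation. *)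
Lemma lposP l t : 0 < t -> t * lweight l <= 1 ->
  lpos l <-> mv_le (leval t (lopp l)) (leval t l).
Proof.
move=> t0 tl; split; last by move=> h; exists t.
move=> [s [s0 sl le]]; pose u := Num.min s t.
have u0 : 0 < u by rewrite lt_min s0 t0.
have us : u / s <= 1 by rewrite ler_pdivrMr // mul1r ge_min lexx.
have ut : u / t <= 1 by rewrite ler_pdivrMr // mul1r ge_min lexx orbT.
have down w k : 0 < w -> w * lweight k <= 1 -> u / w <= 1 ->
    rscale (u / w) (leval w k) = leval u k.
  move=> w0 wk uw; rewrite rscale_leval ?(ltW w0) ?divfK ?gt_eqF //.
  by rewrite divr_ge0 ?ltW.
apply: (@rscale_le_cancel _ _ (u / t)) => //; first by rewrite divr_gt0.
rewrite !down ?lweight_opp //.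
by have := rscale_le (u / s) le; rewrite !down ?lweight_opp.
Qed.

Lemma ex_small w : 0 <= w -> exists t : R, 0 < t /\ t * w <= 1.
Proof.
move=> w0; exists (1 + w)^-1.
have w1 : 0 < 1 + w by rewrite ltr_pwDl.
by rewrite invr_gt0 mulrC ler_pdivrMr // mul1r lerDr.
Qed.

Lemma lpos_perm l m : perm_eq l m -> lpos l -> lpos m.
Proof.
move=> lm [t [t0 tl le]]; exists t; split=> //.
  by rewrite -(lweight_perm lm).
rewrite -(leval_perm t lm) -(leval_perm t (l := lopp l)) //.
exact: perm_map.
Qed.

Lemma lpos_cat l m : lpos l -> lpos m -> lpos (l ++ m).
Proof.
move=> pl pm; have [t [t0]] := ex_small (lweight_ge0 (l ++ m)).
rewrite lweight_cat => small; apply/(lposP t0); first by rewrite lweight_cat.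
have tl : t * lweight l <= 1.
  by rewrite (le_trans _ small) // ler_wpM2l ?(ltW t0) // lerDl lweight_ge0.
have tm : t * lweight m <= 1.
  by rewrite (le_trans _ small) // ler_wpM2l ?(ltW t0) // lerDr lweight_ge0.
rewrite lopp_cat !leval_cat.
by apply: mv_leD; [move/(lposP t0 tl): pl|move/(lposP t0 tm): pm].
Qed.

(** [m] followed by its opposite has equal positive and negative values, which cancel. Together with
    permutations of lists this replaces subtraction. *)
Lemma lpos_cancel l m : lpos (l ++ (m ++ lopp m)) -> lpos l.
Proof.
set k := m ++ lopp m => plk.
have kE t : leval t (lopp k) = leval t k.
  by rewrite /k lopp_cat loppK !leval_cat mv_addC.
clearbody k; have [t [t0 small]] := ex_small (lweight_ge0 (l ++ k)).
move/(lposP t0 small): plk; rewrite lopp_cat !leval_cat kE => le.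
rewrite lweight_cat in small; apply/(lposP t0).
  by rewrite (le_trans _ small) // ler_wpM2l ?(ltW t0) // lerDl lweight_ge0.
by apply: (mv_le_add2r _ _ le); apply: leval_disj; rewrite ?lweight_opp ?(ltW t0).
Qed.

Definition leqv l m := lpos (l ++ lopp m) /\ lpos (m ++ lopp l).

Lemma leval_leqv t l m : 0 < t -> t * (lweight l + lweight m) <= 1 ->
  leval t l ⊕ leval t (lopp m) = leval t m ⊕ leval t (lopp l) -> leqv l m.
Proof.
move=> t0 small e; split; apply/(lposP t0); rewrite ?lweight_cat ?lweight_opp //.
- rewrite lopp_cat loppK !leval_cat e mv_addC; exact: mv_le_refl.
- by rewrite addrC.
- rewrite lopp_cat loppK !leval_cat -e mv_addC; exact: mv_le_refl.
Qed.

Lemma leqv_refl l : leqv l l.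
Proof.
have [t [t0 small]] := ex_small (addr_ge0 (lweight_ge0 l) (lweight_ge0 l)).
exact: leval_leqv t0 small _.
Qed.

Lemma leqv_perm l m : perm_eq l m -> leqv l m.
Proof.
move=> lm; have [h1 h2] := leqv_refl l; split.
  by apply: lpos_perm h1; rewrite perm_cat2l; apply: perm_map.
by apply: lpos_perm h2; rewrite perm_cat2r.
Qed.

Lemma leqv_sym l m : leqv l m -> leqv m l.
Proof. by case. Qed.

Lemma lge_trans l m n : lpos (l ++ lopp m) -> lpos (m ++ lopp n) -> lpos (l ++
  lopp n).
Proof.
move=> lm mn; apply: (@lpos_cancel _ m); apply: lpos_perm (lpos_cat lm mn).
by apply/permP => a; rewrite !count_cat; lia.
Qed.

Lemma leqv_trans m l n : leqv l m -> leqv m n -> leqv l n.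
Proof.
by move=> [lm ml] [mn nm]; split; [exact: lge_trans lm mn|exact: lge_trans nm ml].
Qed.

Lemma lpos_leqv l m : leqv l m -> lpos l -> lpos m.
Proof.
move=> [_ ml] pl; apply: (@lpos_cancel _ l).
apply: lpos_perm (lpos_cat ml pl).
by apply/permP => a; rewrite !count_cat; lia.
Qed.

Lemma leqv_cat l l' m m' : leqv l l' -> leqv m m' -> leqv (l ++ m) (l' ++ m').
Proof.
have half k k' n n' : lpos (k ++ lopp k') -> lpos (n ++ lopp n') ->
    lpos ((k ++ n) ++ lopp (k' ++ n')).
  move=> kk nn; apply: lpos_perm (lpos_cat kk nn).
  by rewrite lopp_cat; apply/permP => a; rewrite !count_cat; lia.
by move=> [h1 h2] [h3 h4]; split; exact: half.
Qed.

Lemma leqv_opp l m : leqv l m -> leqv (lopp l) (lopp m).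
Proof.
move=> [h1 h2]; split; rewrite loppK.
  by apply: lpos_perm h2; exact: permEl (perm_catC _ _).
by apply: lpos_perm h1; exact: permEl (perm_catC _ _).
Qed.

Lemma leqv_subrr l : leqv (l ++ lopp l) [::].
Proof.
by have [h _] := leqv_refl l; split; rewrite /= ?cats0 // lopp_cat loppK;
  apply: lpos_perm h; exact: permEl (perm_catC _ _).
Qed.

Lemma lmul_cons p l m :
  lmul (p :: l) m = [seq (p.1 * q.1, p.2 ⋅ q.2) | q <- m] ++ lmul l m.
Proof. by []. Qed.

Lemma lmul_catl l l' m : lmul (l ++ l') m = lmul l m ++ lmul l' m.
Proof. by elim: l => //= p l IH; rewrite !lmul_cons -catA -IH. Qed.

Lemma lopp_mulr l m : lopp (lmul l m) = lmul l (lopp m).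
Proof.
elim: l => //= p l IH; rewrite !lmul_cons lopp_cat IH; congr cat.
by rewrite /lopp -!map_comp; apply: eq_map => q /=; rewrite mulrN.
Qed.

Lemma lopp_mull l m : lopp (lmul l m) = lmul (lopp l) m.
Proof.
elim: l => //= p l IH; rewrite !lmul_cons lopp_cat IH; congr cat.
by rewrite /lopp -!map_comp; apply: eq_map => q /=; rewrite mulNr.
Qed.

Lemma lmulA l m n : lmul l (lmul m n) = lmul (lmul l m) n.
Proof.
elim: l => //= p l IH; rewrite !lmul_cons lmul_catl IH; congr cat.
elim: m {IH} => //= q m IHm; rewrite !lmul_cons map_cat IHm; congr cat.
by rewrite -map_comp; apply: eq_map => k /=; rewrite mulrA pmv_mulA.
Qed.

Lemma lmul1 m : lmul [:: (1, one)] m = m.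
Proof.
rewrite lmul_cons cats0 -[RHS]map_id; apply: eq_map => q /=.
by rewrite mul1r frp_mulC frp_mul1 -surjective_pairing.
Qed.

Lemma leval_mul1 s t r x m : 0 <= r -> 0 < t -> t * r <= 1 -> 0 < s ->
  s * lweight m <= 1 ->
  leval (t * s) [seq (r * q.1, x ⋅ q.2) | q <- m] = rscale (t * r) x ⋅ leval s m.
Proof.
move=> r0 t0 tr s0; elim: m => [|q m IH] small.
  by rewrite !leval_nil pmv_mul0.
rewrite [map _ _]/= !leval_cons IH ?(small_cons (ltW s0) small) //.
have [-> _] := pmv_mulDr (rscale (t * r) x) (leval_disj_cons (ltW s0) small).
congr mv_add => /=; have [q0|q0] := leP 0 q.1.
  rewrite mulrACA -(@rscaleA _ _ (t * r)) ?mulr_ge0 ?(ltW t0) ?(ltW s0) //.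
    by rewrite rscaleAr rscaleAl.
  exact: small_head (ltW s0) small.
have sq : s * q.1 <= 0 := mulr_ge0_le0 (ltW s0) (ltW q0).
rewrite [rscale (s * _) _]rscale_neg // pmv_mul0 rscale_neg //.
by rewrite mulrACA; apply: mulr_ge0_le0 => //; apply: mulr_ge0 => //; exact: ltW.
Qed.

(** The positive part of a product: positive by positive and negative by negative. *)
Lemma leval_mul s t l m : 0 < t -> t * lweight l <= 1 -> 0 < s ->
  s * lweight m <= 1 ->
  leval (t * s) (lmul l m) =
  leval t l ⋅ leval s m ⊕ leval t (lopp l) ⋅ leval s (lopp m).
Proof.
move=> t0 tl s0 sm; elim: l tl => [|p l IH] tl.
  by rewrite !leval_nil !pmv_mul0l mv_add0.
have tl' := small_cons (ltW t0) tl.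
rewrite lmul_cons leval_cat IH // [lopp _]/= -/(lopp l) !leval_cons.
have [-> _] := pmv_mulDl (leval s m) (leval_disj_cons (ltW t0) tl).
have tlo : t * lweight ((- p.1, p.2) :: lopp l) <= 1.
  by rewrite lweight_cons normrN lweight_opp -lweight_cons.
have [-> _] := pmv_mulDl (leval s (lopp m)) (leval_disj_cons (ltW t0) tlo).
rewrite /= mv_addACA; congr mv_add.
have [p0|p0] := leP 0 p.1.
  rewrite leval_mul1 ?(small_head (ltW t0) tl) //.
  by rewrite [X in _ ⊕ X ⋅ _]rscale_neg ?pmv_mul0l ?mv_add0 // mulrN oppr_le0
    mulr_ge0 // ltW.
rewrite [X in X ⋅ _ ⊕ _]rscale_neg ?pmv_mul0l ?mv_add0l ?mulr_ge0_le0 ?(ltW p0)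
  ?(ltW t0) //.
have -> : [seq (p.1 * q.1, p.2 ⋅ q.2) | q <- m] =
    [seq (- p.1 * q.1, p.2 ⋅ q.2) | q <- lopp m].
  by rewrite -map_comp; apply: eq_map => q /=; rewrite mulrNN.
rewrite leval_mul1 ?lweight_opp ?oppr_ge0 ?(ltW p0) //.
exact: small_head (ltW t0) tlo.
Qed.

Lemma lweight_mul l m : lweight (lmul l m) = lweight l * lweight m.
Proof.
elim: l => [|p l IH]; first by rewrite /lmul /= lweight_nil mul0r.
rewrite lmul_cons lweight_cat IH lweight_cons mulrDl; congr (_ + _).
rewrite /lweight big_map mulr_sumr; apply: eq_bigr => q _ /=; exact: normrM.
Qed.

Lemma small_mul s t l m : 0 < t -> t * lweight l <= 1 -> 0 < s ->
  s * lweight m <= 1 -> t * s * lweight (lmul l m) <= 1.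
Proof.
move=> t0 tl s0 sm; rewrite lweight_mul mulrACA.
by rewrite mulr_ile1 // mulr_ge0 ?lweight_ge0 ?ltW.
Qed.

(** This is [(x1 - x2) (y1 - y2) >= 0] written without subtraction. *)
Lemma mv_cross_le (x1 x2 y1 y2 : A) : mv_le x2 x1 -> mv_le y2 y1 ->
  mv_le (x1 ⋅ y2 ⊕ x2 ⋅ y1) (x1 ⋅ y1 ⊕ x2 ⋅ y2).
Proof.
move=> /mv_subK <- /mv_subK ey.
have dx := mv_disj_sub x1 x2; have dy := mv_disj_sub y1 y2.
set d := mv_mul x1 _ in dx *; set f := mv_mul y1 _ in dy ey *.
have [-> _] := pmv_mulDl y1 dx; have [-> _] := pmv_mulDl y2 dx.
have -> : d ⋅ y1 = d ⋅ f ⊕ d ⋅ y2 by rewrite -{1}ey; have [-> _] := pmv_mulDr d dy.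
rewrite (mv_addC (d ⋅ f)) (mv_addAC _ (d ⋅ f)) (mv_addAC _ (d ⋅ f)).
by rewrite (mv_addAC _ (x2 ⋅ y1)); exact: mv_le_addr.
Qed.

(** This is [(x - y)^2 >= 0]. With [x = u + m], [y = v + m] and [m = x ⊓ y], the f-condition gives
    [u ⋅ v = 0], and the right side is the left one with [u ⋅ u ⊕ v ⋅ v] added. *)
Lemma mv_square_le (x y : A) : mv_le (x ⋅ y ⊕ y ⋅ x) (x ⋅ x ⊕ y ⋅ y).
Proof.
pose m := mv_meet x y; pose u := mv_mul x (mv_neg y); pose v := mv_mul y (mv_neg x).
have uE : u = mv_mul x (mv_neg m) by rewrite mv_sub_meet.
have vE : v = mv_mul y (mv_neg m) by rewrite /m mv_meetC mv_sub_meet.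
have xE : x = u ⊕ m by rewrite uE mv_subK //; exact: mv_meet_lel.
have yE : y = v ⊕ m by rewrite vE mv_subK //; exact: mv_meet_ler.
have du : mv_disj u m by rewrite uE; exact: mv_disj_sub.
have dv : mv_disj v m by rewrite vE; exact: mv_disj_sub.
have uv : u ⋅ v = mv_zero by apply/pmv_mul_meet0/mv_sub_meet_disj.
have mulE a b : mv_disj a m -> mv_disj b m ->
    (a ⊕ m) ⋅ (b ⊕ m) = a ⋅ b ⊕ (a ⋅ m ⊕ b ⋅ m ⊕ m ⋅ m).
  move=> da db; have [-> _] := pmv_mulDl (b ⊕ m) da.
  have [-> _] := pmv_mulDr a db; have [-> _] := pmv_mulDr m db.
  by rewrite (frp_mulC m b) -!mv_addA.
rewrite (frp_mulC y x) xE yE !mulE // uv mv_add0l.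
set P := u ⋅ m; set Q := v ⋅ m; set M := m ⋅ m.
have -> : P ⊕ Q ⊕ M ⊕ (P ⊕ Q ⊕ M) = P ⊕ P ⊕ M ⊕ (Q ⊕ Q ⊕ M).
  rewrite (mv_addACA _ M _ M) (mv_addACA (P ⊕ P) M _ M).
  by rewrite (mv_addACA P Q P Q).
by rewrite (mv_addACA (u ⋅ u)) (mv_addC (u ⋅ u ⊕ _)); exact: mv_le_addr.
Qed.

Lemma lpos_mul l m : lpos l -> lpos m -> lpos (lmul l m).
Proof.
move=> pl pm; have [t [t0 tl]] := ex_small (lweight_ge0 l).
have [s [s0 sm]] := ex_small (lweight_ge0 m).
apply/(lposP (mulr_gt0 t0 s0)); first exact: small_mul.
rewrite lopp_mulr !leval_mul ?lweight_opp // loppK.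
by apply: mv_cross_le; [apply/(lposP t0)|apply/(lposP s0)].
Qed.

Lemma lpos_sq l : lpos (lmul l l).
Proof.
have [t [t0 tl]] := ex_small (lweight_ge0 l).
apply/(lposP (mulr_gt0 t0 t0)); first exact: small_mul.
by rewrite lopp_mulr !leval_mul ?lweight_opp // loppK; exact: mv_square_le.
Qed.

Lemma leqv_mulC l m : leqv (lmul l m) (lmul m l).
Proof.
have [t [t0 tl]] := ex_small (lweight_ge0 l).
have [s [s0 smm]] := ex_small (addr_ge0 (lweight_ge0 m) (lweight_ge0 m)).
have sm : s * lweight m <= 1.
  by rewrite (le_trans _ smm) // ler_wpM2l ?(ltW s0) // lerDl lweight_ge0.
have e m' : lweight m' = lweight m ->
    leval (t * s) (lmul l m') = leval (t * s) (lmul m' l).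
  move=> wm; rewrite leval_mul ?wm // (mulrC t s) leval_mul ?wm //.
  by rewrite frp_mulC (frp_mulC (leval _ (lopp _))).
apply: (leval_leqv (mulr_gt0 t0 s0)).
  rewrite !lweight_mul (mulrC (lweight m)) -mulrDr mulrACA.
  rewrite mulr_ile1 ?mulr_ge0 ?addr_ge0 ?lweight_ge0 ?(ltW t0) ?(ltW s0) //.
by rewrite (lopp_mulr l m) (lopp_mull m l) (e m erefl) (e (lopp m)) // lweight_opp.
Qed.

Lemma leqv_mull l l' m : leqv l l' -> leqv (lmul l m) (lmul l' m).
Proof.
(* [k] is null, so its positive and negative parts have the same value and its products are null
   too; [m] and its opposite give the two inequalities. *)
move=> [h1 h2]; set k := l ++ lopp l' in h1.
have kE : leqv k [::].
  split; rewrite ?cats0 //= /k lopp_cat loppK.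
  by apply: lpos_perm h2; apply/permP => a; rewrite !count_cat; lia.
have [t [t0 tk]] := ex_small (lweight_ge0 k).
have [s [s0 sm]] := ex_small (lweight_ge0 m).
have e : leval t k = leval t (lopp k).
  have [] := kE; rewrite cats0 => /(lposP t0 tk) ko.
  have tko : t * lweight (lopp k) <= 1 by rewrite lweight_opp.
  by move=> /(lposP t0 tko); rewrite loppK => ok; exact: mv_le_anti.
have pm n : lweight n = lweight m -> lpos (lmul k n).
  move=> wn; apply/(lposP (mulr_gt0 t0 s0)); first by apply: small_mul; rewrite ?wn.
  rewrite lopp_mulr !leval_mul ?lweight_opp ?wn // loppK e mv_addC.
  exact: mv_le_refl.
split.
  by have := pm m erefl; rewrite /k lmul_catl -lopp_mull.
have := pm (lopp m) (lweight_opp m).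
rewrite -lopp_mulr /k lmul_catl -lopp_mull lopp_cat loppK.
by apply: lpos_perm; apply/permP => a; rewrite !count_cat; lia.
Qed.

Lemma leqv_mulr l m m' : leqv m m' -> leqv (lmul l m) (lmul l m').
Proof.
move=> mm; apply: leqv_trans (leqv_mulC l m) _.
exact: leqv_trans (leqv_mull l mm) (leqv_mulC m' l).
Qed.

Lemma lpos_seq1 r x : 0 <= r -> lpos [:: (r, x)].
Proof.
move=> r0; have [t [t0 small]] := ex_small (lweight_ge0 [:: (r, x)]).
apply/(lposP t0 small); rewrite !leval_seq1 /= rscale_neg; first exact: mv_le0.
by rewrite mulrN oppr_le0 mulr_ge0 // ltW.
Qed.

(** Faithfulness of the envelope, used for [1 != 0] and to keep the opposites of powers of [a] out
    of the positive cone. *)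
Lemma lpos_neg x : lpos [:: (-1, x)] -> x = mv_zero.
Proof.
have [t [t0 small]] := ex_small (lweight_ge0 [:: (-1, x)]).
move/(lposP t0 small); rewrite !leval_seq1 /= opprK mulr1 mulrN1.
rewrite (@rscale_neg (- t)) ?oppr_le0 ?(ltW t0) // => /mv_le0_eq.
apply: rscale_eq0 => //; move: small.
by rewrite lweight_cons lweight_nil normrN normr1 addr0 mulr1.
Qed.

Lemma leqv_scaleD r s x : leqv [:: (r + s, x)] [:: (r, x); (s, x)].
Proof.
pose w := `|r| + `|s| + (`|r| + `|s|).
have w0 : 0 <= w by rewrite !addr_ge0.
have [t [t0 small]] := ex_small w0.
apply: (leval_leqv t0).
  rewrite !lweight_cons lweight_nil !addr0 /=.
  by rewrite (le_trans _ small) // ler_wpM2l ?(ltW t0) // lerD2r ler_normD.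
rewrite !leval_cons !leval_nil !mv_add0 /= !mulrN mulrDr.
have rscale_max (u : R) : rscale u x = rscale (Num.max 0 u) x.
  by have [u0|u0] := leP u 0; rewrite // !rscale_neg.
have bound : `|t * r| + `|t * s| + (`|t * r| + `|t * s|) <= 1.
  by rewrite !normrM (gtr0_norm t0) -!mulrDr.
move: (t * r) (t * s) bound => a b bound.
have comb (u v : R) : 0 <= u -> 0 <= v -> u + v <= 1 ->
    rscale u x ⊕ rscale v x = rscale (u + v) x.
  by move=> u0 v0 uv; have [] := rscaleDl x u0 v0 uv.
have ma (u : R) : `|u| = Num.max 0 u + Num.max 0 (- u).
  have [u0|u0] := leP u 0; first by rewrite ler0_norm // max_r ?oppr_ge0 // add0r.
  by rewrite gtr0_norm // max_l ?addr0 // oppr_le0 ltW.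
have mb (u : R) : Num.max 0 u - Num.max 0 (- u) = u.
  have [u0|u0] := leP u 0; first by rewrite max_r ?oppr_ge0 // sub0r opprK.
  by rewrite max_l ?subr0 // oppr_le0 ltW.
have m0 (u : R) : 0 <= Num.max 0 u by rewrite le_max lexx.
have mD (u v : R) : Num.max 0 (u + v) <= Num.max 0 u + Num.max 0 v.
  by rewrite ge_max addr_ge0 //= lerD // le_max lexx orbT.
rewrite !ma in bound.
(* Positive and negative parts enter only through linear relations, which avoids a case analysis on
   the signs of [a], [b] and [a + b]; the doubled bound keeps both sums below 1. *)
have key (c c' a1 a2 b1 b2 : R) :
    a1 + a2 + (b1 + b2) + (a1 + a2 + (b1 + b2)) <= 1 ->
    0 <= a1 -> 0 <= a2 -> 0 <= b1 -> 0 <= b2 -> 0 <= c -> 0 <= c' ->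
    c - c' = a1 - a2 + (b1 - b2) -> c <= a1 + b1 -> c' <= a2 + b2 ->
    rscale c x ⊕ (rscale a2 x ⊕ rscale b2 x) =
    rscale a1 x ⊕ rscale b1 x ⊕ rscale c' x.
  by move=> *; rewrite !comb; [congr rscale|..]; lra.
rewrite (rscale_max (a + b)) (rscale_max (- a)) (rscale_max (- b)).
rewrite (rscale_max a) (rscale_max b) (rscale_max (- (a + b))).
apply: key; rewrite ?m0 ?mb // ?mD //.
by rewrite opprD mD.
Qed.

Lemma leqv_add x y : mv_disj x y -> leqv [:: (1, x ⊕ y)] [:: (1, x); (1, y)].
Proof.
move=> xy; pose w : R := 3%:R; have [t [t0 small]] := @ex_small w (ler0n _ _).
apply: (leval_leqv t0).
  by rewrite !lweight_cons lweight_nil normr1; move: small; rewrite /w; lra.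
rewrite !leval_cons !leval_nil !mv_add0 /= mulr1 mulrN1.
have [-> _] := rscaleDr t xy.
by rewrite !(@rscale_neg (- t)) ?oppr_le0 ?(ltW t0) // !mv_add0.
Qed.

Lemma leqv_scale r x : 0 <= r -> r <= 1 -> leqv [:: (1, rscale r x)] [:: (r, x)].
Proof.
move=> r0 r1; pose w : R := 1 + `|r|.
have [t [t0 small]] := @ex_small w (addr_ge0 ler01 (normr_ge0 _)).
have t1 : t <= 1.
  by move: small; rewrite /w mulrDr mulr1 => h; rewrite (le_trans _ h) // lerDl
    mulr_ge0 // ltW.
apply: (leval_leqv t0).
  by rewrite !lweight_cons !lweight_nil normr1 !addr0.
rewrite !leval_seq1 /= mulr1 mulrN1 (rscaleA x (ltW t0) t1 r0 r1).
rewrite (@rscale_neg (- t)) ?oppr_le0 ?(ltW t0) //.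
by rewrite (@rscale_neg (t * - r)) // mulrN oppr_le0 mulr_ge0 // ltW.
Qed.

End SignedCombinations.

(** * The ring of combinations and its positive cone *)

Section Envelope.
Variables (R : realType) (A : frplusType R).
Local Open Scope quotient_scope.
Local Notation lin := {classic seq {classic R * A}}.
Local Notation one := (mv_neg mv_zero : A).
Implicit Types (l m n : lin) (x y z : A) (r s : R).

Definition lin_eq : rel lin := fun l m => `[< leqv l m >].

Lemma lin_eq_refl : reflexive lin_eq.
Proof. by move=> l; apply/asboolP; exact: leqv_refl. Qed.

Lemma lin_eq_sym : symmetric lin_eq.
Proof. by move=> l m; apply/asboolP/asboolP; exact: leqv_sym. Qed.

Lemma lin_eq_trans : transitive lin_eq.
Proof.
move=> m l n /asboolP lm /asboolP mn; apply/asboolP; exact: leqv_trans lm mn.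
Qed.

Canonical lin_equiv := EquivRel lin_eq lin_eq_refl lin_eq_sym lin_eq_trans.

(** Nontriviality is an argument because the ring structure of this type requires [1 != 0]. *)
Definition envelope of (exists x : A, x <> mv_zero) : Type := {eq_quot lin_equiv}.

Section Ring.
Hypothesis A0 : exists x : A, x <> mv_zero.
Local Notation D := (envelope A0).
HB.instance Definition _ := Choice.on D.

Definition env_class l : D := \pi_({eq_quot lin_equiv}) l.
Definition env_repr (x : D) : lin := repr (x : {eq_quot lin_equiv}).

Lemma env_reprK : cancel env_repr env_class.
Proof. exact: reprK. Qed.

Lemma env_classP l m : env_class l = env_class m <-> leqv l m.
Proof. by split=> [/eqmodP/asboolP|lm]; last by apply/eqmodP/asboolP. Qed.

Lemma env_repr_class l : leqv (env_repr (env_class l)) l.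
Proof. by apply/env_classP; rewrite env_reprK. Qed.

Lemma env_ind (P : D -> Prop) : (forall l, P (env_class l)) -> forall x : D, P x.
Proof. by move=> Pl x; rewrite -(env_reprK x). Qed.

Let add (x y : D) : D := env_class (env_repr x ++ env_repr y).
Let opp (x : D) : D := env_class (lopp (env_repr x)).
Let mul (x y : D) : D := env_class (lmul (env_repr x) (env_repr y)).
Let zero : D := env_class [::].
Let unit1 : D := env_class [:: (1, one)].

Let addE l m : add (env_class l) (env_class m) = env_class (l ++ m).
Proof. by apply/env_classP; apply: leqv_cat; exact: env_repr_class. Qed.
Let oppE l : opp (env_class l) = env_class (lopp l).
Proof. by apply/env_classP; apply: leqv_opp; exact: env_repr_class. Qed.
Let mulE l m : mul (env_class l) (env_class m) = env_class (lmul l m).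
Proof.
apply/env_classP; apply: leqv_trans (leqv_mull _ (env_repr_class l)) _.
exact: leqv_mulr (env_repr_class m).
Qed.

Let addA : associative add.
Proof.
by elim/env_ind => l; elim/env_ind => m; elim/env_ind => n; rewrite !addE catA.
Qed.
Let addC : commutative add.
Proof.
elim/env_ind => l; elim/env_ind => m; rewrite !addE; apply/env_classP.
by apply: leqv_perm; exact: permEl (perm_catC _ _).
Qed.
Let add0 : left_id zero add.
Proof. by elim/env_ind => l; rewrite addE. Qed.
Let addN : left_inverse zero opp add.
Proof.
elim/env_ind => l; rewrite addC oppE addE; apply/env_classP; exact: leqv_subrr.
Qed.
HB.instance Definition _ := GRing.isZmodule.Build D addA addC add0 addN.

Let mulA : associative mul.
Proof.
by elim/env_ind => l; elim/env_ind => m; elim/env_ind => n; rewrite !mulE lmulA.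
Qed.
Let mulC : commutative mul.
Proof.
elim/env_ind => l; elim/env_ind => m; rewrite !mulE; apply/env_classP.
exact: leqv_mulC.
Qed.
Let mul1 : left_id unit1 mul.
Proof. by elim/env_ind => l; rewrite mulE lmul1. Qed.
Let mulDl : left_distributive mul add.
Proof.
elim/env_ind => l; elim/env_ind => m; elim/env_ind => n.
by rewrite !(addE, mulE) lmul_catl.
Qed.
Let unit1_neq0 : unit1 != zero.
Proof.
apply/eqP => /env_classP[_ /= /lpos_neg one0]; have [x] := A0; apply.
by rewrite -(frp_mul1 x) one0 pmv_mul0.
Qed.
HB.instance Definition _ :=
  GRing.Zmodule_isComNzRing.Build D mulA mulC mul1 mulDl unit1_neq0.

Lemma env_classD l m : env_class (l ++ m) = env_class l + env_class m.
Proof. by rewrite -addE. Qed.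
Lemma env_classN l : env_class (lopp l) = - env_class l.
Proof. by rewrite -oppE. Qed.
Lemma env_classM l m : env_class (lmul l m) = env_class l * env_class m.
Proof. by rewrite -mulE. Qed.

Definition env_pos : set D := fun x : D => lpos (env_repr x).

Lemma env_posE l : env_pos (env_class l) <-> lpos l.
Proof.
have h := env_repr_class l; split; apply: lpos_leqv => //; exact: leqv_sym.
Qed.

Lemma env_pos_preordering : preordering env_pos.
Proof.
split.
- elim/env_ind => l; elim/env_ind => m /env_posE pl /env_posE pm.
  by rewrite -env_classD; apply/env_posE; exact: lpos_cat.
- elim/env_ind => l; elim/env_ind => m /env_posE pl /env_posE pm.
  by rewrite -env_classM; apply/env_posE; exact: lpos_mul.
- elim/env_ind => l; rewrite -env_classM; apply/env_posE; exact: lpos_sq.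
Qed.

Definition env_scalar r : D := env_class [:: (r, one)].
Definition env_elt x : D := env_class [:: (1, x)].

Let env_scalar_zmod : zmod_morphism env_scalar.
Proof.
move=> r s; rewrite /env_scalar -env_classN -env_classD.
by apply/env_classP; exact: leqv_scaleD.
Qed.
Let env_scalar_monoid : monoid_morphism env_scalar.
Proof.
split=> // r s; rewrite /env_scalar -env_classM.
by rewrite lmul_cons /= frp_mul1.
Qed.
HB.instance Definition _ := GRing.isZmodMorphism.Build R D env_scalar
  env_scalar_zmod.
HB.instance Definition _ := GRing.isMonoidMorphism.Build R D env_scalar
  env_scalar_monoid.

Lemma env_eltD x y : mv_disj x y -> env_elt (mv_add x y) = env_elt x + env_elt y.
Proof.
by move=> xy; rewrite /env_elt -env_classD; apply/env_classP; exact: leqv_add.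
Qed.

Lemma env_eltM x y : env_elt (pmv_mul x y) = env_elt x * env_elt y.
Proof. by rewrite /env_elt -env_classM lmul_cons /= mulr1. Qed.

Lemma env_elt1 : env_elt one = 1.
Proof. by []. Qed.

Lemma env_elt0 : env_elt mv_zero = 0.
Proof.
have d : mv_disj (mv_zero : A) mv_zero by rewrite /mv_disj mv_mul0.
by have := env_eltD d; rewrite mv_add0 => /eqP; rewrite addrC -subr_eq subrr =>
  /eqP.
Qed.

Lemma env_eltN x : env_elt (mv_neg x) = 1 - env_elt x.
Proof.
rewrite -env_elt1 -(mv_addN x) env_eltD; last exact: mv_mulN.
by rewrite addrC addKr.
Qed.

Lemma env_eltZ (a : {i01 R}) x : env_elt (mv_scale a x) = env_scalar a%:num *
  env_elt x.
Proof.
rewrite /env_scalar /env_elt -env_classM lmul_cons /= mulr1 frp_mulC frp_mul1.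
by apply/env_classP; rewrite -rscale_num; apply: leqv_scale; rewrite ?ge0 ?le1.
Qed.

Lemma env_elt_pos x : env_pos (env_elt x).
Proof. by apply/env_posE; apply: lpos_seq1. Qed.

Lemma env_elt_overflow x y :
  env_elt x + env_elt y = env_elt (mv_add x y) + env_elt (mv_mul y x).
Proof.
have dx : mv_disj x (mv_meet y (mv_neg x)).
  apply: mv_disjC; apply: mv_disj_le (mv_meet_ler _ _) _.
  by rewrite /mv_disj mv_mulC mv_mulN.
have dy : mv_disj (mv_mul y x) (mv_meet y (mv_neg x)).
  by have := mv_disj_sub y (mv_meet y (mv_neg x)); rewrite mv_sub_meet mv_negK.
rewrite mv_addE env_eltD // {1}(mv_overflow x y) env_eltD //.
by rewrite -addrA [env_elt (mv_meet _ _) + _]addrC.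
Qed.

(** The two factors are the differences of [y] and [x^*] in opposite directions, hence
    lattice-disjoint. *)
Lemma env_elt_saturated x y : (1 - env_elt (mv_add x y)) * env_elt (mv_mul y x) = 0.
Proof.
rewrite -env_eltN -env_eltM -env_elt0; congr env_elt; apply: pmv_mul_meet0.
have := mv_sub_meet_disj y (mv_neg x).
by rewrite mv_negK mv_meetC mv_negD.
Qed.

(** If [- x^k] is positive then [x^k = 0] by [lpos_neg], against semiprimeness; for [k = 0] this
    says [1 = 0], so that [x = x ⋅ 1 = 0]. *)
Lemma env_pos_exp x k : x <> mv_zero -> ~ env_pos (- env_elt x ^+ k).
Proof.
move=> x0; pose p i := iter i (pmv_mul x) one.
have -> : env_elt x ^+ k = env_elt (p k).
  elim: k => [|k IH]; first by rewrite expr0.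
  by rewrite exprS IH -env_eltM.
rewrite /env_elt -env_classN => /env_posE/lpos_neg.
case: k => [|k] pk0.
  by apply: x0; rewrite -(frp_mul1 x) [X in pmv_mul x X]pk0 pmv_mul0.
apply: x0; apply: (@frp_semiprime R A _ k.+1) => //.
by rewrite iteropS -pk0 /p iterSr frp_mul1.
Qed.

End Ring.
End Envelope.

Lemma ex_field_hom (R : realType) (A : frplusType R) (a : A) : a <> mv_zero ->
  exists (K : realFieldType) (k : {rmorphism R -> K}) (g : A -> K),
  [/\ forall x y, g (mv_add x y) = Num.min 1 (g x + g y),
      forall x, g (mv_neg x) = 1 - g x,
      forall x y, g (pmv_mul x y) = g x * g y &
      forall (c : {i01 R}) x, g (mv_scale c x) = k c%:num * g x] /\
  [/\ g mv_zero = 0, forall x, 0 <= g x & 0 < g a].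
Proof.
move=> a0; have A0 : exists x : A, x <> mv_zero by exists a.
have [K [h [hpos ha]]] := ex_real_field (@env_pos_preordering R A A0)
  (env_elt_pos A0 a) (fun k => @env_pos_exp R A A0 a k a0).
exists K, (h \o env_scalar A0), (h \o env_elt A0).
have gpos x : 0 <= h (env_elt A0 x) by apply/hpos/env_elt_pos.
have gN x : h (env_elt A0 (mv_neg x)) = 1 - h (env_elt A0 x).
  by rewrite env_eltN rmorphB rmorph1.
have g1 x : h (env_elt A0 x) <= 1 by rewrite -subr_ge0 -gN.
split; last by split=> //=; rewrite env_elt0 rmorph0.
split=> [x y|//|x y|c x] /=.
- have := congr1 h (env_elt_overflow A0 x y); rewrite !rmorphD /= => ->.
  have := congr1 h (env_elt_saturated A0 x y).
  rewrite rmorphM rmorphB rmorph1 rmorph0 => /eqP; rewrite mulf_eq0 =>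
    /orP[|/eqP ->].
    by rewrite subr_eq0 => /eqP <-; rewrite min_l // lerDl.
  by rewrite addr0 min_r.
- by rewrite env_eltM rmorphM.
- by rewrite env_eltZ rmorphM.
Qed.

(** * Embedding into an ultrapower *)

Section LocalHomomorphism.
Variables (R : realType) (A : frplusType R).
Local Notation cA := {classic A}.
Implicit Types (F : seq cA) (s : seq {i01 R}) (x y : A).

(** [f] is total so that local maps can be glued pointwise, but, apart from its value at zero, it is
    constrained only on operations applied to [F] and [s]. *)
Definition local_hom F s (f : A -> unit_interval R) :=
  [/\ f mv_zero = mv_zero,
      forall x y, x \in F -> y \in F -> f (mv_add x y) = mv_add (f x) (f y),
      forall x, x \in F -> f (mv_neg x) = mv_neg (f x),
      forall x y, x \in F -> y \in F -> f (pmv_mul x y) = pmv_mul (f x) (f y) &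
      forall c x, c \in s -> x \in F -> f (mv_scale c x) = mv_scale c (f x)].

Lemma ex_local_hom (a : A) F s : a <> mv_zero ->
  exists f, local_hom F s f /\ f a <> mv_zero.
Proof.
move=> a0; have [K [k [g [[gD gN gM gZ] [g0 gpos ga]]]]] := ex_field_hom a0.
have g1 x : g x <= 1 by rewrite -subr_ge0 -gN.
pose sums : seq cA := [seq mv_add x y | x <- F, y <- F].
pose negs : seq cA := [seq mv_neg x | x <- F].
pose prods : seq cA := [seq pmv_mul x y | x <- F, y <- F].
pose scales : seq cA := [seq mv_scale c x | c <- s, x <- F].
pose G : seq cA := [:: mv_zero, a & F ++ sums ++ negs ++ prods ++ scales].
have [B [iota [phi [phiK dense gen]]]] := ex_sign_dense k [seq g x | x <- G].
have /choice[b bP] : forall x : cA, exists b, x \in G -> phi b = g x.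
  move=> x; have [xG|xG] := boolP (x \in G); last by exists 0.
  by have [b <-] := gen _ (map_f (fun x : cA => g x) xG); exists b.
(* The first two lists force values in [[0,1]] and keep [a] positive. A truncated sum is encoded by
   the sign of [x + y - 1], which selects the branch of the minimum, and by the equations of both
   branches. *)
pose Q := [seq b x | x <- G] ++ [seq 1 - b x | x <- G] ++
  [seq b (mv_add x y) - (b x + b y) | x <- F, y <- F] ++
  [seq b (mv_add x y) - 1 | x <- F, y <- F] ++
  [seq b x + b y - 1 | x <- F, y <- F] ++
  [seq b (mv_neg x) - (1 - b x) | x <- F] ++
  [seq b (pmv_mul x y) - b x * b y | x <- F, y <- F] ++
  [seq b (mv_scale c x) - iota c%:num * b x | c <- s, x <- F].
have [psi [psiK psiS]] := dense Q.
have eq0 q : q \in Q -> phi q = 0 -> psi q = 0.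
  move=> qQ /eqP; rewrite -sgz_eq0 psiS // sgz_eq0; by move/eqP.
have ge0P q : q \in Q -> 0 <= phi q -> 0 <= psi q.
  by move=> qQ; rewrite -sgz_ge0 psiS // sgz_ge0.
have inQ : forall q, q \in Q = [|| q \in [seq b x | x <- G],
   q \in [seq 1 - b x | x <- G],
   q \in [seq b (mv_add x y) - (b x + b y) | x <- F, y <- F],
   q \in [seq b (mv_add x y) - 1 | x <- F, y <- F],
   q \in [seq b x + b y - 1 | x <- F, y <- F],
   q \in [seq b (mv_neg x) - (1 - b x) | x <- F],
   q \in [seq b (pmv_mul x y) - b x * b y | x <- F, y <- F] |
   q \in [seq b (mv_scale c x) - iota c%:num * b x | c <- s, x <- F]].
  by move=> q; rewrite !mem_cat.
have G0 : (mv_zero : cA) \in G by rewrite mem_head.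
have Ga : (a : cA) \in G by rewrite !inE eqxx orbT.
have GF x : (x : cA) \in F -> (x : cA) \in G.
  by move=> xF; rewrite !inE mem_cat xF !orbT.
have GD x y : (x : cA) \in F -> (y : cA) \in F -> (mv_add x y : cA) \in G.
  move=> xF yF; rewrite !inE !mem_cat.
  by rewrite (allpairs_f (fun x y : cA => mv_add x y : cA) xF yF) !orbT.
have GN x : (x : cA) \in F -> (mv_neg x : cA) \in G.
  move=> xF; rewrite !inE !mem_cat.
  by rewrite (map_f (fun x : cA => mv_neg x : cA) xF) !orbT.
have GM x y : (x : cA) \in F -> (y : cA) \in F -> (pmv_mul x y : cA) \in G.
  move=> xF yF; rewrite !inE !mem_cat.
  by rewrite (allpairs_f (fun x y : cA => pmv_mul x y : cA) xF yF) !orbT.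
have GZ c x : c \in s -> (x : cA) \in F -> (mv_scale c x : cA) \in G.
  move=> cs xF; rewrite !inE !mem_cat.
  by rewrite (allpairs_f (fun c (x : cA) => mv_scale c x : cA) cs xF) !orbT.
(* Clipping only makes [f] total: on [G] the values already lie in [[0,1]]. *)
pose f x : unit_interval R := clip (psi (b x)).
have fE x : (x : cA) \in G -> (f x : {i01 R})%:num = psi (b x).
  move=> xG; apply: clip_num.
    by apply: ge0P; [rewrite inQ (map_f b xG)|rewrite bP].
  rewrite -subr_ge0 -(rmorph1 psi) -rmorphB; apply: ge0P.
    by rewrite inQ (map_f (fun x : cA => 1 - b x) xG) orbT.
  by rewrite rmorphB rmorph1 bP // subr_ge0.
have val_eq (u v : unit_interval R) : (u : {i01 R})%:num = (v : {i01 R})%:num ->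
  u = v.
  exact: val_inj.
have psi_eq q r : q - r \in Q -> phi q = phi r -> psi q = psi r.
  move=> qrQ e; apply/eqP; rewrite -subr_eq0 -rmorphB; apply/eqP/eq0 => //.
  by rewrite rmorphB e subrr.
have psi_le q r : q - r \in Q -> phi r <= phi q -> psi r <= psi q.
  by move=> qrQ e; rewrite -subr_ge0 -rmorphB; apply: ge0P => //; rewrite
    rmorphB subr_ge0.
exists f; split; last first.
  move=> /(congr1 (fun u : unit_interval R => (u : {i01 R})%:num)); rewrite fE
    //= => e.
  have := psiS (b a); rewrite inQ (map_f b Ga) e sgz0 bP // gtr0_sgz // => /(_ isT).
  by [].
split.
- apply: val_eq; rewrite fE //=; apply: eq0; last by rewrite bP.
  by rewrite inQ (map_f b G0).
- move=> x y xF yF; apply: val_eq; rewrite fE ?GD //= !fE ?GF //.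
  have eD : phi (b (mv_add x y)) = Num.min 1 (phi (b x) + phi (b y)).
    by rewrite !bP ?GD ?GF // gD.
  have Q1 : b (mv_add x y) - (b x + b y) \in Q.
    rewrite inQ; apply/or4P; constructor 3.
    exact: (allpairs_f (fun x y : cA => b (mv_add x y) - (b x + b y)) xF yF).
  have Q2 : b (mv_add x y) - 1 \in Q.
    rewrite inQ; apply/or4P; constructor 4; apply/orP; left.
    exact: (allpairs_f (fun x y : cA => b (mv_add x y) - 1) xF yF).
  have Q3 : b x + b y - 1 \in Q.
    rewrite inQ; apply/or4P; constructor 4; apply/orP; right; apply/orP; left.
    exact: (allpairs_f (fun x y : cA => b x + b y - 1) xF yF).
  rewrite -(rmorph1 psi) -rmorphD.
  have [h|h] := leP 1 (phi (b x) + phi (b y)).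
    rewrite (psi_eq _ 1 Q2); last by rewrite eD min_l ?rmorph1.
    by rewrite min_l //; apply: psi_le => //; rewrite rmorph1 rmorphD.
  have le1 : psi (b (mv_add x y)) <= psi 1.
    by rewrite rmorph1 -fE ?GD // le1.
  move: le1; rewrite (psi_eq _ (b x + b y) Q1); last by rewrite eD min_r
    ?rmorphD // ltW.
  by move=> le1; rewrite min_r.
- move=> x xF; apply: val_eq; rewrite fE ?GN //= fE ?GF //.
  rewrite -(rmorph1 psi) -rmorphB; apply: psi_eq; last first.
    by rewrite rmorphB rmorph1 !bP ?GN ?GF // gN.
  rewrite inQ; apply/or4P; constructor 4; apply/or4P; constructor 3.
  exact: (map_f (fun x : cA => b (mv_neg x) - (1 - b x)) xF).
- move=> x y xF yF; apply: val_eq; rewrite fE ?GM //= !fE ?GF //.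
  rewrite -rmorphM; apply: psi_eq; last first.
    by rewrite rmorphM !bP ?GM ?GF // gM.
  rewrite inQ; apply/or4P; constructor 4; apply/or4P; constructor 4; apply/orP;
    left.
  exact: (allpairs_f (fun x y : cA => b (pmv_mul x y) - b x * b y) xF yF).
- move=> c x cs xF; apply: val_eq; rewrite fE ?GZ //= fE ?GF //.
  rewrite -[c%:num]psiK -rmorphM; apply: psi_eq; last first.
    by rewrite rmorphM phiK !bP ?GZ ?GF // gZ.
  rewrite inQ; apply/or4P; constructor 4; apply/or4P; constructor 4; apply/orP;
    right.
  exact: (allpairs_f (fun c (x : cA) => b (mv_scale c x) - iota c%:num * b x) cs
    xF).
Qed.

End LocalHomomorphism.

(** * The filter of finite parts *)

Section FinitePartsFilter.
Variables (X Y : eqType).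
Local Notation J := (seq X * seq Y)%type.

Definition finite_parts_above (j : J) : set J :=
  [set j' : J | {subset j.1 <= j'.1} /\ {subset j.2 <= j'.2}]%classic.

Definition finite_parts_filter : set_system J :=
  [set S | exists j, finite_parts_above j `<=` S]%classic.

Lemma finite_parts_proper : ProperFilter finite_parts_filter.
Proof.
apply: Build_ProperFilter_ex; last first.
  split=> [|P Q [j jP] [j' jQ]|P Q PQ [j jP]].
  - by exists ([::], [::]); exact: subsetT.
  - exists (j.1 ++ j'.1, j.2 ++ j'.2) => i [h1 h2]; split.
      by apply: jP; split=> x xj; [apply: h1|apply: h2]; rewrite mem_cat xj.
    by apply: jQ; split=> x xj; [apply: h1|apply: h2]; rewrite mem_cat xj orbT.
  - by exists j; exact: subset_trans PQ.
by move=> P [j jP]; exists j; apply: jP; split.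
Qed.

End FinitePartsFilter.

Theorem theorem3p22 (R : realType) (A : frplusType R) :
  exists (J : Type) (U : set_system J) (UU : UltraFilter U) (I : Type)
    (f : A -> (I -> ultrapower UU (unit_interval R))),
    fmv_embedding f.
Proof.
pose J := (seq {classic A} * seq {i01 R})%type.
have [U [UU FU]] := ultraFilterLemma (@finite_parts_proper {classic A} {i01 R}).
(* One coordinate for each nonzero [a], with local maps that do not kill [a]. *)
pose I := {a : A | a <> mv_zero}.
have /choice[h hP] : forall ij : I * J, exists f : A -> unit_interval R,
    local_hom ij.2.1 ij.2.2 f /\ f (sval ij.1) <> mv_zero.
  by case=> -[a a0] [F s] /=; exact: ex_local_hom.
exists J, U, UU, I, (fun x i => ultra_class UU (fun j => h (i, j) x)).
set f := fun x i => _.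
(* What holds as soon as a finite part contains [F] and [s] holds [U]-almost everywhere. *)
have near_hom (F : seq {classic A}) (s : seq {i01 R}) i (P : J -> Prop) :
    (forall j, local_hom j.1 j.2 (h (i, j)) -> {subset F <= j.1} ->
      {subset s <= j.2} -> P j) -> U P.
  move=> HP; apply: FU; exists (F, s) => j [Fj sj].
  by apply: HP => //; exact: (hP (i, j)).1.
have homf : fmv_morphism f.
  split.
  - move=> x y; apply/funext => i; rewrite [RHS]ultra_classD; apply/ultra_classP.
    apply: (near_hom [:: x; y] [::] i) => j [_ hD _ _ _] Fj _.
    by apply: hD; apply: Fj; rewrite !inE eqxx ?orbT.
  - move=> x; apply/funext => i; rewrite [RHS]ultra_classN; apply/ultra_classP.
    apply: (near_hom [:: x] [::] i) => j [_ _ hN _ _] Fj _.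
    by apply/hN/Fj/mem_head.
  - apply/funext => i; apply/ultra_classP.
    by apply: (near_hom [::] [::] i) => j [h0 _ _ _ _].
  - move=> x y; apply/funext => i; rewrite [RHS]ultra_classM; apply/ultra_classP.
    apply: (near_hom [:: x; y] [::] i) => j [_ _ _ hM _] Fj _.
    by apply: hM; apply: Fj; rewrite !inE eqxx ?orbT.
  - move=> c x; apply/funext => i; rewrite [RHS]ultra_classZ; apply/ultra_classP.
    apply: (near_hom [:: x] [:: c] i) => j [_ _ _ _ hZ] Fj sj.
    by apply: hZ; [apply: sj|apply: Fj]; exact: mem_head.
split=> // x y fxy.
(* Injectivity reduces to a trivial kernel through the differences [x ⊙ y^*] and [y ⊙ x^*]. *)
have fM u v : f (mv_mul u v) = mv_mul (f u) (f v).
  by rewrite /mv_mul !(fmv_morphN homf, fmv_morphD homf).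
have f_eq0 d : f d = mv_zero -> d = mv_zero.
  (* In the coordinate of [d] every local map is nonzero at [d], whereas [f d = 0] would make
     [U]-almost all of them vanish there. *)
  move=> fd; apply: contrapT => d0; pose i : I := exist _ d d0.
  have /(congr1 (@^~ i)) := fd; rewrite -(fmv_morph0 homf) => /ultra_classP Ud.
  have U0 : U [set j | h (i, j) mv_zero = mv_zero]%classic.
    by apply: (near_hom [::] [::] i) => j [h0 _ _ _ _].
  have [j [/= jd j0]] := filter_ex (filterI Ud U0).
  by have [_] := hP (i, j); apply; rewrite jd.
by apply: mv_le_anti; apply/mv_leP/f_eq0; rewrite fM (fmv_morphN homf) fxy mv_mulN.
Qed.
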